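(* Let $G=(V,E)$ be a $3$-regular simple pfaffian graph. Then the number of perfect matchings of $G$ is at most $3^{\frac{|V|}{4}}$. Moreover, if $G$ is a planar $3$-regular simple graph, then the number of perfect matchings of $G$ equals $3^{\frac{|V|}{4}}$ if and only if $G$ is a disjoint union of graphs each of which is (isomorphic to) $K_4$ or $C_4\times K_2$.
   Context: Graphs are finite. For an orientation of the edges of $G$, the skew symmetric adjacency matrix is $S(G)=[s_{uv}]_{u,v\in V}$ with $s_{uv}=1$ if the edge $(u,v)\in E$ is oriented from $u$ to $v$, $s_{uv}=-1$ if it is oriented from $v$ to $u$, and $s_{uv}=0$ if $(u,v)\notin E$. $G$ is pfaffian if it has an orientation with $\det S(G)$ equal to the square of the number of perfect matchings of $G$. (Every planar graph is pfaffian, by a theorem of Kasteleyn.) $K_n$ is the complete graph and $C_n$ the cycle on $n$ vertices. $C_4\times K_2$ is the cartesian product of graphs: $(u,u')$ and $(v,v')$ are adjacent iff either $u=v$ and $u'v'$ is an edge, or $u'=v'$ and $uv$ is an edge. *)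

(* Defs.v *)
From HB Require Import structures.
From mathcomp Require Import all_boot all_order all_algebra.
From mathcomp Require Import all_classical all_reals all_analysis.

Set Implicit Arguments.
Unset Strict Implicit.
Unset Printing Implicit Defensive.

Import Order.TTheory GRing.Theory Num.Theory.
Import numFieldNormedType.Exports.
Local Open Scope classical_set_scope.
Local Open Scope ring_scope.

Record sgraph := SGraph {
  vertex :> finType;
  adj : rel vertex;
  adj_sym : symmetric adj;
  adj_irrefl : irreflexive adj }.

Definition regular (d : nat) (G : sgraph) : Prop :=
  forall u : G, #|[set v : G | adj u v]%SET| = d.

Definition edges (G : sgraph) : {set {set G}} :=
  [set A : {set G} | [exists u, exists v, adj u v && (A == [set u; v]%SET)]]%SET.

Definition perfect_matching (G : sgraph) (M : {set {set G}}) : bool :=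
  (M \subset edges G) &&
  [forall x : G, #|[set A in M | x \in A]%SET| == 1%N].

Definition num_pm (G : sgraph) : nat :=
  #|[set M : {set {set G}} | perfect_matching M]%SET|.

(* [o u v] means that the edge uv is oriented from u to v. *)
Definition orientation (G : sgraph) (o : rel G) : Prop :=
  forall u v : G, (adj u v -> o u v = ~~ o v u) /\ (o u v -> adj u v).

(* The same enumeration of the vertices indexes the rows and the columns, so the
   determinant does not depend on it. *)
Definition skew_adj_mx (G : sgraph) (o : rel G) : 'M[int]_#|G| :=
  \matrix_(i, j)
    if o (enum_val i) (enum_val j) then 1
    else if o (enum_val j) (enum_val i) then -1
    else 0.

Definition pfaffian (G : sgraph) : Prop :=
  exists o : rel G,
    orientation o /\ \det (skew_adj_mx o) = ((num_pm G)%:R : int) ^+ 2.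

(* [p] places the vertices in the plane and [c A] parametrizes by [0, 1] the
   simple arc drawn for the edge [A], in one of its two directions. *)
Definition plane_drawing (R : realType) (G : sgraph)
    (p : G -> R * R) (c : {set G} -> R -> R * R) : Prop :=
  [/\ injective p,
      forall A : {set G}, A \in edges G ->
        {within `[0, 1]%classic, continuous (c A)} /\
        {in `[0, 1] &, injective (c A)},
      forall A : {set G}, A \in edges G -> exists u v : G,
        [/\ A = [set u; v]%SET, c A 0 = p u & c A 1 = p v],
      forall A : {set G}, A \in edges G ->
        forall (t : R) (x : G), t \in `]0, 1[ -> c A t <> p x
    & forall A B : {set G}, A \in edges G -> B \in edges G -> A != B ->
        forall s t : R, s \in `]0, 1[ -> t \in `]0, 1[ -> c A s <> c B t].

Definition planar (R : realType) (G : sgraph) : Prop :=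
  exists (p : G -> R * R) (c : {set G} -> R -> R * R), plane_drawing p c.

Definition isomorphic (G H : sgraph) : Prop :=
  exists2 f : G -> H, bijective f & forall u v, adj (f u) (f v) = adj u v.

Section CompleteGraph.
Variable n : nat.
Definition complete_adj : rel 'I_n := fun i j => i != j.
Lemma complete_adj_sym : symmetric complete_adj.
Proof. by move=> i j; rewrite /complete_adj eq_sym. Qed.
Lemma complete_adj_irrefl : irreflexive complete_adj.
Proof. by move=> i; rewrite /complete_adj eqxx. Qed.
Definition complete_graph := SGraph complete_adj_sym complete_adj_irrefl.
End CompleteGraph.

(* The cycle on n vertices for n >= 3; [i != j] only matters for n = 1. *)
Section CycleGraph.
Variable n : nat.
Definition cycle_adj : rel 'I_n :=
  fun i j => (i != j) && ((j == ordS i) || (i == ordS j)).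
Lemma cycle_adj_sym : symmetric cycle_adj.
Proof. by move=> i j; rewrite /cycle_adj eq_sym orbC. Qed.
Lemma cycle_adj_irrefl : irreflexive cycle_adj.
Proof. by move=> i; rewrite /cycle_adj eqxx. Qed.
Definition cycle_graph := SGraph cycle_adj_sym cycle_adj_irrefl.
End CycleGraph.

Section CartesianProduct.
Variables G H : sgraph.
Definition cartesian_adj : rel (G * H)%type := fun x y =>
  (x.1 == y.1) && adj x.2 y.2 || (x.2 == y.2) && adj x.1 y.1.
Lemma cartesian_adj_sym : symmetric cartesian_adj.
Proof.
move=> x y; rewrite /cartesian_adj (eq_sym x.1) (eq_sym x.2).
by rewrite (adj_sym x.1) (adj_sym x.2).
Qed.
Lemma cartesian_adj_irrefl : irreflexive cartesian_adj.
Proof. by move=> x; rewrite /cartesian_adj !adj_irrefl !andbF. Qed.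
Definition cartesian_product := SGraph cartesian_adj_sym cartesian_adj_irrefl.
End CartesianProduct.

Section DisjointUnion.
Variables (I : finType) (F : I -> sgraph).
Let V : finType := {i : I & vertex (F i)}.
(* When the tags agree, [tagged_as x y] is the second component of [y]. *)
Definition union_adj : rel V := fun x y =>
  (tag x == tag y) && adj (tagged x) (tagged_as x y).
Lemma union_adj_sym : symmetric union_adj.
Proof.
suff sub x y : union_adj x y -> union_adj y x.
  by move=> x y; apply/idP/idP; apply: sub.
case: x y => i x [j y] /andP[/= /eqP eij]; subst j.
rewrite /union_adj /= eqxx /=.
by rewrite !(@tagged_asE _ (fun i => vertex (F i)) (existT _ i _)) adj_sym.
Qed.
Lemma union_adj_irrefl : irreflexive union_adj.
Proof.
case=> i x; rewrite /union_adj /=.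
by rewrite (@tagged_asE _ (fun i => vertex (F i)) (existT _ i _)) adj_irrefl andbF.
Qed.
Definition disjoint_union := SGraph union_adj_sym union_adj_irrefl.
End DisjointUnion.

(* Main.v *)
(** Hadamard's inequality gives [det S ^ 2 <= 3 ^ n], hence the bound when
[det S] is the square of the number of perfect matchings.  In the case of
equality the rows of [S] are orthogonal, so any two vertices have an even
number of common neighbours, and exploring the surroundings of a vertex of such
a cubic graph exhibits [K_4] or the cube.  Conversely those graphs have 3 and 9
perfect matchings, and lower bounds suffice since planarity supplies the upper
one.

That planarity forces [num_pm ^ 2 <= |det S|] for some orientation is proved by
crossing parities, without the Jordan curve theorem.  Replace the edges by
polygons fine enough that those of disjoint edges stay disjoint, and order the
vertices lexicographically.  For disjoint edges [ab] and [cd], whether [{a, b}] and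
[{c, d}] interleave in this order is the parity of the number of incidences
"an end of one edge lies below the other edge".  The sign of a
perfect matching in the Pfaffian is the parity of its interleaved pairs of
edges, so it is a product over the edges [e] of the matching of a sign that
depends on [e] only (all vertices outside [e] are counted once), and this sign
can be absorbed in the orientation of [e]. *)
Require Import Defs.
From mathcomp Require Import all_boot all_order all_algebra all_fingroup.
From mathcomp Require Import ring lra zify.

Set Implicit Arguments.
Unset Strict Implicit.
Unset Printing Implicit Defensive.

Import Order.TTheory GRing.Theory Num.Theory.

(** * Perfect matchings and their listings by permutations *)

Section PerfectMatchings.
Variable G : sgraph.
Implicit Types (M : {set {set G}}) (A B : {set G}) (x : G).

Lemma edgeP A : reflect (exists u v : G, adj u v /\ A = [set u; v]) (A \in edges G).
Proof.
rewrite inE; apply: (iffP existsP) => [[u /existsP[v /andP[uv /eqP->]]]|[u [v [uv ->]]]].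
  by exists u, v.
by exists u; apply/existsP; exists v; rewrite uv eqxx.
Qed.

Lemma edge_set2 (u v : G) : ([set u; v] \in edges G) = adj u v.
Proof.
apply/edgeP/idP => [[u' [v' [uv' E]]]|uv]; last by exists u, v.
have u'v' : u' != v' by apply: contraTneq uv' => ->; rewrite adj_irrefl.
have /set2P u'E : u' \in [set u; v] by rewrite E !inE eqxx.
have /set2P v'E : v' \in [set u; v] by rewrite E !inE eqxx orbT.
by case: u'E v'E uv' u'v' => -> [] ->; rewrite ?eqxx // adj_sym.
Qed.

Lemma pm_edge M A : perfect_matching M -> A \in M -> A \in edges G.
Proof. by case/andP => /subsetP sub _; apply: sub. Qed.

Lemma pm_cover M x : perfect_matching M -> exists2 A, A \in M & x \in A.
Proof.
case/andP => _ /forallP/(_ x)/cards1P[A /setP/(_ A)].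
by rewrite !inE eqxx => /andP[]; exists A.
Qed.

Lemma pm_uniq M A B x : perfect_matching M ->
  A \in M -> B \in M -> x \in A -> x \in B -> A = B.
Proof.
case/andP => _ /forallP/(_ x)/cards1P[C /setP E] AM BM xA xB.
have := E A; have := E B; rewrite !inE AM BM xA xB.
by move=> /esym/eqP-> /esym/eqP->.
Qed.

(** Each edge of [M'] shares a vertex with some edge of [M], and [M'] has only one edge at that
    vertex. *)
Lemma pm_sub_eq M M' : perfect_matching M -> perfect_matching M' ->
  M \subset M' -> M = M'.
Proof.
move=> pM pM' sMM'; apply/eqP; rewrite eqEsubset sMM'; apply/subsetP => A AM'.
have /edgeP[u [v [_ A_uv]]] := pm_edge pM' AM'.
have uA : u \in A by rewrite A_uv !inE eqxx.
have [B BM uB] := pm_cover u pM.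
by rewrite (pm_uniq pM' AM' (subsetP sMM' B BM) uA uB).
Qed.

Lemma pm_card M : perfect_matching M -> #|G| = (#|M| + #|M|)%N.
Proof.
move=> pM; rewrite addnn -muln2 -cardsT; apply: card_uniform_partition.
  move=> A /(pm_edge pM)/edgeP[u [v [uv ->]]]; rewrite cards2.
  by case: eqP uv => // ->; rewrite adj_irrefl.
apply/and3P; split.
- rewrite eqEsubset subsetT; apply/subsetP => x _.
  by have [A AM xA] := pm_cover x pM; apply/bigcupP; exists A.
- apply/trivIsetP => A B AM BM; apply: contraNT => /pred0Pn[x /andP[xA xB]].
  by apply/eqP; apply: pm_uniq pM AM BM xA xB.
- apply/negP => /(pm_edge pM)/edgeP[u [v [_ /setP/(_ u)]]].
  by rewrite !inE eqxx.
Qed.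

Section Listing.
Variables (m : nat) (e : 'I_(m + m) -> G).
Hypothesis e_bij : bijective e.
Implicit Types s t p : 'S_(m + m).

Definition listed_edge s (i : 'I_m) := [set e (s (lshift m i)); e (s (rshift m i))].
Definition listed_matching s := [set listed_edge s i | i : 'I_m].
Definition lists_edges s := [forall i, adj (e (s (lshift m i))) (e (s (rshift m i)))].

(** The hyperoctahedral group on [m] pairs: the ambiguity in listing the edges of one matching. *)
Definition pair_stabilizer : {set 'S_(m + m)} :=
  [set p : 'S_(m + m) | [forall i : 'I_m, exists j : 'I_m,
    [set p (lshift m i); p (rshift m i)] == [set lshift m j; rshift m j]]].

Let e_inj : injective e. Proof. exact: bij_inj. Qed.

Lemma listed_edge_cover s x : exists i, x \in listed_edge s i.
Proof.
have [e' _ eK] := e_bij; rewrite -[x]eK -[e' x](permKV s).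
have [j|j] := splitP (s^-1%g (e' x)) => h; exists j; rewrite !inE.
  by rewrite (_ : s^-1%g _ = lshift m j) ?eqxx //; apply: val_inj.
by rewrite (_ : s^-1%g _ = rshift m j) ?eqxx ?orbT //; apply: val_inj.
Qed.

Lemma listed_edge_uniq s x i j :
  x \in listed_edge s i -> x \in listed_edge s j -> i = j.
Proof.
have [ll rr] := (@lshift_inj m m, @rshift_inj m m).
by move=> /set2P[]-> /set2P[] /e_inj/perm_inj/eqP;
  rewrite ?(inj_eq ll) ?(inj_eq rr) ?eq_lrshift ?eq_rlshift // => /eqP.
Qed.

Lemma listed_matching_pm s : lists_edges s -> perfect_matching (listed_matching s).
Proof.
move=> /forallP s_adj; apply/andP; split.
  by apply/subsetP => _ /imsetP[i _ ->]; apply/edgeP; do 2!eexists; split; [exact: s_adj|].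
apply/forallP => x; have [i xi] := listed_edge_cover s x.
apply/cards1P; exists (listed_edge s i); apply/setP => A; rewrite !inE.
apply/andP/eqP => [[/imsetP[j _ ->] xj]|->]; first by rewrite (listed_edge_uniq xi xj).
by rewrite imset_f.
Qed.

Lemma pm_listed M : #|M| = m -> perfect_matching M ->
  exists2 t, lists_edges t & listed_matching t = M.
Proof.
move=> Mm pM.
have /fin_all_exists[f fP] (i : 'I_m) : exists uv : G * G, adj uv.1 uv.2 /\
    enum_val (cast_ord (esym Mm) i) = [set uv.1; uv.2].
  have /edgeP[u [v [uv ->]]] := pm_edge pM (enum_valP (cast_ord (esym Mm) i)).
  by exists (u, v).
pose A i := [set (f i).1; (f i).2].
have AM i : A i \in M by rewrite /A -(fP i).2 enum_valP.
have Ainj i j x : x \in A i -> x \in A j -> i = j.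
  move=> xi xj; have := pm_uniq pM (AM i) (AM j) xi xj.
  by rewrite /A -(fP i).2 -(fP j).2 => /enum_val_inj/cast_ord_inj.
have [e' eK e'K] := e_bij.
(* First ends fill the first half of the positions, second ends the second half. *)
pose h (x : 'I_(m + m)) := match split x with inl i => (f i).1 | inr i => (f i).2 end.
have f12 i : (f i).1 != (f i).2.
  by apply: contraTneq (fP i).1 => ->; rewrite adj_irrefl.
have hinj : injective (e' \o h).
  apply: inj_comp; first exact: can_inj e'K.
  move=> x y; rewrite /h; case: (splitP x) => i xi; case: (splitP y) => j yj E.
  - have /Ainj ij : (f i).1 \in A i by rewrite !inE eqxx.
    by apply: ord_inj; rewrite xi yj (ij j) // E !inE eqxx.
  - have /Ainj ij : (f i).1 \in A i by rewrite !inE eqxx.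
    have {}ij : i = j by apply: ij; rewrite E !inE eqxx orbT.
    by move: (f12 j); rewrite -E ij eqxx.
  - have /Ainj ij : (f i).2 \in A i by rewrite !inE eqxx orbT.
    have {}ij : i = j by apply: ij; rewrite E !inE eqxx.
    by move: (f12 j); rewrite -E ij eqxx.
  - have /Ainj ij : (f i).2 \in A i by rewrite !inE eqxx orbT.
    by apply: ord_inj; rewrite xi yj (ij j) // E !inE eqxx orbT.
pose t := perm hinj.
have tl i : e (t (lshift m i)) = (f i).1 by rewrite permE /= e'K /h (unsplitK (inl i)).
have tr i : e (t (rshift m i)) = (f i).2 by rewrite permE /= e'K /h (unsplitK (inr i)).
have te : lists_edges t by apply/forallP => i; rewrite tl tr (fP i).1.
exists t => //; apply: pm_sub_eq (listed_matching_pm te) pM _.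
by apply/subsetP => _ /imsetP[i _ ->]; rewrite /listed_edge tl tr AM.
Qed.

(** [s] and [t] differ by a permutation [p] of the positions, applied first because products act
    from left to right; hence a right coset. The matching is unchanged exactly when [p] respects the
    pairing of positions. *)
Lemma listing_fiber t : lists_edges t ->
  [set s | lists_edges s & listed_matching s == listed_matching t] =
  (pair_stabilizer :* t)%g.
Proof.
move=> te; apply/setP => s; rewrite mem_rcoset; set p := (s * t^-1)%g.
have sE (x : 'I_(m + m)) : s x = t (p x) by rewrite permM permKV.
have imE (x y : 'I_(m + m)) : [set e (s x); e (s y)] = (e \o t) @: [set p x; p y].
  by rewrite imsetU !imset_set1 /= -!sE.
have et_inj : injective (e \o t) := inj_comp e_inj perm_inj.
rewrite !inE; apply/andP/forallP => [[_ /eqP stM] i|pP].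
  have : listed_edge s i \in listed_matching t by rewrite -stM imset_f.
  case/imsetP => j _; rewrite /listed_edge imE.
  rewrite -[RHS](_ : (e \o t) @: [set lshift m j; rshift m j] = _); last first.
    by rewrite imsetU !imset_set1.
  by move=> /(imset_inj et_inj) E; apply/existsP; exists j; rewrite E.
have sub i : listed_edge s i \in listed_matching t.
  have /existsP[j /eqP E] := pP i; rewrite /listed_edge imE E.
  by apply/imsetP; exists j => //; rewrite imsetU !imset_set1.
have se : lists_edges s.
  apply/forallP => i; rewrite -edge_set2.
  exact: pm_edge (listed_matching_pm te) (sub i).
split=> //; apply/eqP; apply: pm_sub_eq; try exact: listed_matching_pm.
by apply/subsetP => _ /imsetP[i _ ->].
Qed.

(** All fibres of [listed_matching] are cosets of [pair_stabilizer], so they have the same size. *)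
Lemma card_listings :
  #|[set s | lists_edges s]| = (num_pm G * #|pair_stabilizer|)%N.
Proof.
have GE : #|G| = (m + m)%N by rewrite -(bij_eq_card e_bij) card_ord.
rewrite -sum1dep_card (partition_big listed_matching (@perfect_matching G)) /=; last first.
  by move=> s /listed_matching_pm.
rewrite (eq_bigr (fun=> #|pair_stabilizer|)); last first.
  move=> M pM; have Mm : #|M| = m.
    by apply: double_inj; rewrite -!addnn -GE (pm_card pM).
  have [t te tM] := pm_listed Mm pM.
  by rewrite sum1dep_card -tM (listing_fiber te) card_rcoset.
by rewrite sum_nat_cond_const /num_pm cardsE.
Qed.

End Listing.
End PerfectMatchings.

(** * Cubic graphs with even common neighbourhoods *)

Definition common_nbrs (G : sgraph) (u v : G) : {set G} :=
  [set w | adj u w & adj v w].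

Notation cube := (cartesian_product (cycle_graph 4) (complete_graph 2)).

(** Only a homomorphism is asked for: between regular graphs of equal degree, counting neighbours
    makes an injective one an isomorphism onto a component. *)
Definition spans_component (H G : sgraph) (u : G) : Prop :=
  exists h : H -> G, [/\ injective h, forall x y, adj x y -> adj (h x) (h y),
    exists x, h x = u & forall x, connect (@adj G) u (h x)].

Definition cube_index (p : 'I_4 * 'I_2) : nat := p.1 + 4 * p.2.

Lemma cube_index_lt p : cube_index p < 8.
Proof. by case: p => [[i hi] [j hj]]; rewrite /cube_index /=; lia. Qed.

Lemma cube_index_inj : injective cube_index.
Proof.
move=> [[i hi] [j hj]] [[i' hi'] [j' hj']]; rewrite /cube_index /= => E.
by congr pair; apply: val_inj => /=; lia.
Qed.

Section CubicEven.
Variable G : sgraph.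
Hypothesis G_cubic : regular 3 G.
Hypothesis G_even : forall u v : G, u != v -> ~~ odd #|common_nbrs u v|.
Implicit Types u v w a b c x y z : G.

Lemma adj_neq u v : adj u v -> u != v.
Proof. by apply: contraTneq => ->; rewrite adj_irrefl. Qed.

Lemma cubic_nbrs u : exists a b c, uniq [:: a; b; c] /\
  forall w, adj u w = (w \in [:: a; b; c]).
Proof.
have := G_cubic u; rewrite cardE; set s := enum _ => s3.
have su : uniq s := enum_uniq _.
have sE w : adj u w = (w \in s) by rewrite mem_enum inE.
by case: s s3 su sE => [|a [|b [|c [|]]]] //= _ su sE; exists a, b, c.
Qed.

Lemma cubic_nbrsE u a b c : uniq [:: a; b; c] -> adj u a -> adj u b -> adj u c ->
  forall w, adj u w = (w \in [:: a; b; c]).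
Proof.
move=> abc ua ub uc w; have /esym/eqP := G_cubic u.
rewrite -[3]/(size [:: a; b; c]) -(card_uniqP abc) => card3.
have sub : [:: a; b; c] \subset [set v | adj u v].
  by apply/subsetP => v; rewrite !inE => /or3P[]/eqP->.
have /subset_cardP/(_ sub)/(_ w) : #|[:: a; b; c]| = #|[set v | adj u v]| by apply/eqP.
by rewrite !inE.
Qed.

(** A set of even size that contains [w] has another element. *)
Lemma second_common_nbr u v w : u != v -> adj u w -> adj v w ->
  exists w', [/\ w' != w, adj u w' & adj v w'].
Proof.
move=> uv uw vw; have := G_even uv; rewrite (cardsD1 w) inE uw vw /= negbK => od.
have /card_gt0P[w'] : 0 < #|common_nbrs u v :\ w| by case: #|_| od.
by rewrite !inE => /and3P[? ? ?]; exists w'.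
Qed.

(** Both neighbourhoods would be [a], [b], [c], giving an odd number of common neighbours. *)
Lemma common_nbrs_neq3 u x a b c : uniq [:: a; b; c] -> u != x ->
  adj u a -> adj u b -> adj u c -> adj x a -> adj x b -> adj x c -> False.
Proof.
move=> abc ux ua ub uc xa xb xc; have := G_even ux.
have -> : common_nbrs u x = [set v | adj u v].
  apply/setP => v; rewrite !inE (cubic_nbrsE abc ua ub uc) (cubic_nbrsE abc xa xb xc).
  by rewrite andbb.
by rewrite G_cubic.
Qed.

(** [u] and [a] share [b], hence a second neighbour, which can only be [c]; likewise for [u] and
    [b], which share [a]. *)
Lemma triangle_K4 u a b c : uniq [:: a; b; c] ->
  adj u a -> adj u b -> adj u c -> adj a b -> spans_component (complete_graph 4) u.
Proof.
move=> abc ua ub uc ab; have uE := cubic_nbrsE abc ua ub uc.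
have ba : adj b a by rewrite adj_sym.
have ac : adj a c.
  have [w [wb uw aw]] := second_common_nbr (adj_neq ua) ub ab.
  by move: uw wb (adj_neq aw); rewrite uE !inE => /or3P[]/eqP E; rewrite E ?eqxx // in aw *.
have bc : adj b c.
  have [w [wa uw bw]] := second_common_nbr (adj_neq ub) ua ba.
  by move: uw wa (adj_neq bw); rewrite uE !inE => /or3P[]/eqP E; rewrite E ?eqxx // in bw *.
pose s := [:: u; a; b; c].
have su : uniq s by rewrite /= !inE !negb_or !adj_neq.
exists (fun i : 'I_4 => nth u s i); split.
- by move=> i j /eqP; rewrite nth_uniq // => /eqP/val_inj.
- move=> [[|[|[|[|//]]]] hi] [[|[|[|[|//]]]] hj] //= _; by rewrite // adj_sym.
- by exists ord0.
- by move=> [[|[|[|[|//]]]] hi] /=; rewrite ?connect0 // connect1.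
Qed.

Lemma triangle_free_cube u a b c : uniq [:: a; b; c] ->
  adj u a -> adj u b -> adj u c -> ~~ adj a b -> ~~ adj a c -> ~~ adj b c ->
  spans_component cube u.
Proof.
move=> abc ua ub uc ab ac bc; have uE := cubic_nbrsE abc ua ub uc.
have [anb anc bnc] : [/\ a != b, a != c & b != c].
  by move: abc; rewrite /= !inE negb_or andbT => /andP[/andP[]].
have [au bu cu] : [/\ adj a u, adj b u & adj c u] by rewrite !(adj_sym _ u).
(* The second common neighbours [x], [y], [z] of the three pairs from [a], [b],
   [c] are forced to share their last neighbour [w]. *)
have [x [xu ax bx]] := second_common_nbr anb au bu.
have [y [yu ay cy]] := second_common_nbr anc au cu.
have [z [zu bz cz]] := second_common_nbr bnc bu cu.
(* This keeps [x], [y] and [z] distinct: if two of them coincided, the vertex would see all of [a],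
   [b], [c]. *)
have no3 v : v != u -> adj v a -> adj v b -> adj v c -> False.
  by rewrite eq_sym => uv; apply: common_nbrs_neq3 abc uv ua ub uc.
have xa : adj x a by rewrite adj_sym.
have xb : adj x b by rewrite adj_sym.
have ya : adj y a by rewrite adj_sym.
have yc : adj y c by rewrite adj_sym.
have zb : adj z b by rewrite adj_sym.
have zc : adj z c by rewrite adj_sym.
have xy : x != y by apply/eqP => E; rewrite -E in yc; exact: no3 xu xa xb yc.
have xz : x != z by apply/eqP => E; rewrite -E in zc; exact: no3 xu xa xb zc.
have yz : y != z by apply/eqP => E; rewrite -E in zb; exact: no3 yu ya zb yc.
have aE : forall w, adj a w = (w \in [:: u; x; y]).
  by apply: cubic_nbrsE => //; rewrite /= !inE negb_or !(eq_sym u) xu yu xy.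
have bE : forall w, adj b w = (w \in [:: u; x; z]).
  by apply: cubic_nbrsE => //; rewrite /= !inE negb_or !(eq_sym u) xu zu xz.
have cE : forall w, adj c w = (w \in [:: u; y; z]).
  by apply: cubic_nbrsE => //; rewrite /= !inE negb_or !(eq_sym u) yu zu yz.
have [w [wa xw yw]] := second_common_nbr xy xa ya.
have wb : w != b.
  apply: contraTneq yw => ->; rewrite adj_sym bE !inE !negb_or yu yz.
  by rewrite eq_sym xy.
have wc : w != c.
  by apply: contraTneq xw => ->; rewrite adj_sym cE !inE !negb_or xu xy.
have xE : forall v, adj x v = (v \in [:: a; b; w]).
  by apply: cubic_nbrsE => //; rewrite /= !inE negb_or anb !(eq_sym _ w) wa wb.
have zw : adj z w.
  have [v [vb xv zv]] := second_common_nbr xz xb zb.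
  move: xv vb; rewrite xE !inE => /or3P[]/eqP E; rewrite E ?eqxx // in zv *.
  by move: zv; rewrite adj_sym aE !inE (negbTE zu) !(eq_sym z) (negbTE xz) (negbTE yz).
(* The order follows [cube_index]: [u a x b] and [c y w z] are opposite 4-cycles, joined position by
   position. *)
pose s := [:: u; a; x; b; c; y; w; z].
have xnb : ~~ adj u x.
  rewrite uE !inE !negb_or (eq_sym x) (adj_neq ax) (eq_sym x) (adj_neq bx) /=.
  by apply: contraNneq ac => <-.
have uw : u != w by apply: contraTneq xw => <-; rewrite adj_sym.
have az : a != z by apply: contraTneq bz => <-; rewrite adj_sym.
have xc : x != c by apply: contraTneq ax => ->.
have yb : y != b by apply: contraTneq ay => ->.
have su : uniq s.
  by rewrite /= !inE !negb_or !andbT; do !(apply/andP; split);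
    solve [done | exact: adj_neq | rewrite eq_sym; first [done | exact: adj_neq]].
exists (fun p : cube => nth u s (cube_index p)); split.
- move=> p q /eqP; rewrite nth_uniq //; try exact: cube_index_lt.
  by move=> /eqP/cube_index_inj.
- move=> [[[|[|[|[|//]]]] i] [[|[|//]] j]] [[[|[|[|[|//]]]] i'] [[|[|//]] j']] //= _;
  by rewrite // adj_sym.
- by exists (ord0, ord0).
- have cx v : adj u v -> connect (@adj G) u v by apply: connect1.
  have cxx v v' : adj u v -> adj v v' -> connect (@adj G) u v'.
    by move=> uv vv'; apply: connect_trans (connect1 uv) (connect1 vv').
  have cw : connect (@adj G) u w by apply: connect_trans (cxx _ _ ua ax) (connect1 xw).
  by move=> [[[|[|[|[|//]]]] i] [[|[|//]] j]]; rewrite /=; eauto using connect0.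
Qed.

Lemma cubic_even_spans u :
  spans_component (complete_graph 4) u \/ spans_component cube u.
Proof.
have [a [b [c [abc uE]]]] := cubic_nbrs u.
have [ua ub uc] : [/\ adj u a, adj u b & adj u c] by rewrite !uE !inE !eqxx !orbT.
have [anb anc bnc] : [/\ a != b, a != c & b != c].
  by move: abc; rewrite /= !inE negb_or andbT => /andP[/andP[]].
have [ab|ab] := boolP (adj a b); first by left; apply: triangle_K4 abc ua ub uc ab.
have [ac|ac] := boolP (adj a c).
  left; apply: triangle_K4 (_ : uniq [:: a; c; b]) ua uc ub ac.
  by rewrite /= !inE negb_or anb anc eq_sym bnc.
have [bc|bc] := boolP (adj b c).
  left; apply: triangle_K4 (_ : uniq [:: b; c; a]) ub uc ua bc.
  by rewrite /= !inE negb_or bnc !(eq_sym _ a) anb anc.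
by right; apply: triangle_free_cube abc ua ub uc ab ac bc.
Qed.
End CubicEven.

(** * Decomposition into connected components *)

Lemma isomorphic_sym (G H : sgraph) : isomorphic G H -> isomorphic H G.
Proof.
move=> [f [g fK gK] fadj]; exists g; first by exists f.
by move=> u v; rewrite -fadj !gK.
Qed.

Lemma complete_graph_regular n : regular n (complete_graph n.+1).
Proof.
move=> u; have -> : [set v : complete_graph n.+1 | adj u v] = ~: [set u].
  by apply/setP => v; rewrite !inE eq_sym.
by rewrite cardsC1 card_ord.
Qed.

Lemma cube_regular : regular 3 cube.
Proof.
move=> u; rewrite -sum1dep_card big_mkcond /=.
rewrite -(pair_bigA _ (fun i j => if cartesian_adj u (i, j) then 1 else 0)) /=.
by case: u => [[[|[|[|[|//]]]] i] [[|[|//]] j]]; rewrite !big_ord_recl !big_ord0.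
Qed.

Lemma union_adjE (I : finType) (F : I -> sgraph) i (x y : F i) :
  @union_adj I F (existT _ i x) (existT _ i y) = adj x y.
Proof.
by rewrite /union_adj /= eqxx (@tagged_asE _ (fun i => vertex (F i)) (existT _ i _)).
Qed.

Section InducedSubgraph.
Variables (G : sgraph) (P : {set G}).
Definition induced_adj : rel {x : G | x \in P} := fun x y => adj (val x) (val y).
Lemma induced_adj_sym : symmetric induced_adj.
Proof. by move=> x y; rewrite /induced_adj adj_sym. Qed.
Lemma induced_adj_irrefl : irreflexive induced_adj.
Proof. by move=> x; rewrite /induced_adj adj_irrefl. Qed.
Definition induced_subgraph := SGraph induced_adj_sym induced_adj_irrefl.
End InducedSubgraph.

Section Components.
Variable G : sgraph.

Definition component (u : G) : {set G} := [set v | fingraph.root (@adj G) v == u].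

Lemma adj_connect_sym : connect_sym (@adj G).
Proof. by apply: sym_connect_sym => u v; rewrite adj_sym. Qed.

(** By equal degrees, [h] maps each neighbourhood onto a neighbourhood. So [h] reflects adjacency,
    and its image, closed under adjacency, is the whole component. *)
Lemma component_iso (H : sgraph) (u : G) d :
  regular d G -> regular d H -> roots (@adj G) u -> spans_component H u ->
  isomorphic (induced_subgraph (component u)) H.
Proof.
move=> Gd Hd /eqP ur [h [h_inj h_adj [x0 hx0] h_conn]].
have hN x : [set w | adj (h x) w] = h @: [set y | adj x y].
  apply/esym/eqP; rewrite eqEcard card_imset // Gd Hd leqnn andbT.
  by apply/subsetP => _ /imsetP[y /[!inE] xy ->]; exact: h_adj.
have h_adjE x y : adj (h x) (h y) = adj x y.
  apply/idP/idP => [hxy|]; last exact: h_adj.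
  have : h y \in [set w | adj (h x) w] by rewrite inE.
  by rewrite hN (mem_imset _ _ h_inj) inE.
have h_comp x : h x \in component u.
  by rewrite inE -[X in _ == X]ur (root_connect adj_connect_sym) adj_connect_sym.
have h_onto v : v \in component u -> exists x, h x = v.
  rewrite inE -[X in _ == X]ur (root_connect adj_connect_sym) adj_connect_sym -hx0.
  case/connectP => p; elim: p x0 {ur hx0 h_comp h_conn} => [|w p IH] x0 /=.
    by move=> _ ->; exists x0.
  case/andP => xw; have : w \in [set w | adj (h x0) w] by rewrite inE.
  by rewrite hN => /imsetP[y _ ->]; exact: IH.
pose k x : induced_subgraph (component u) := Sub (h x) (h_comp x).
apply: isomorphic_sym; exists k => [|x y]; last by rewrite -h_adjE.
have k_inj : injective k by move=> x y /(congr1 val)/h_inj.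
apply: inj_card_bij => //; rewrite -(card_codom k_inj); apply: subset_leq_card.
apply/subsetP => -[v vP] _; have [x hx] := h_onto v vP.
by apply/codomP; exists x; apply: val_inj.
Qed.

Lemma components_iso :
  isomorphic G (disjoint_union (fun i : {u : G | roots (@adj G) u} =>
                                  induced_subgraph (component (val i)))).
Proof.
set U := disjoint_union _; apply: isomorphic_sym.
pose g (p : U) : G := val (tagged p).
have rootE (p : U) : fingraph.root (@adj G) (g p) = val (tag p).
  by have := valP (tagged p); rewrite inE => /eqP.
have g_inj : injective g.
  case=> i x [j y] E; have ij : i = j.
    by apply: val_inj; rewrite -(rootE (existT _ i x)) -(rootE (existT _ j y)) E.
  by subst j; congr existT; apply: val_inj.
exists g => [|p q].
  have rP (v : G) : roots (@adj G) (fingraph.root (@adj G) v).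
    exact: roots_root adj_connect_sym _.
  have cP (v : G) : v \in component (fingraph.root (@adj G) v) by rewrite inE.
  pose F (i : {u : G | roots (@adj G) u}) := {v | v \in component (val i)}.
  pose f v := existT F (exist _ (fingraph.root (@adj G) v) (rP v)) (exist _ v (cP v)).
  exists f => // p.
  exact: g_inj.
have [pq|pq] := eqVneq (tag p) (tag q).
  by case: p q pq => i x [j y] /= ij; subst j; rewrite union_adjE.
rewrite /= /union_adj (negbTE pq); apply/negbTE.
apply: contraNN pq => gpq; rewrite -(inj_eq val_inj) -!rootE.
by rewrite (root_connect adj_connect_sym) connect1.
Qed.
End Components.

Theorem cubic_even_union (G : sgraph) : regular 3 G ->
  (forall u v : G, u != v -> ~~ odd #|common_nbrs u v|) ->
  exists (I : finType) (F : I -> sgraph),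
    (forall i : I, isomorphic (F i) (complete_graph 4) \/ isomorphic (F i) cube) /\
    isomorphic G (disjoint_union F).
Proof.
move=> G3 Ge; exists {u : G | roots (@adj G) u}.
exists (fun i => induced_subgraph (component (val i))); split; last exact: components_iso.
case=> u ur; have [spK|spC] := cubic_even_spans G3 Ge u.
  left; apply: component_iso G3 _ ur spK; exact: complete_graph_regular.
right; apply: component_iso G3 _ ur spC; exact: cube_regular.
Qed.

(** * Perfect matchings of disjoint unions *)

(** A matching is encoded by the involution that sends each vertex to its partner. This form can be
    checked by evaluation on small graphs and extends directly to disjoint unions. *)
Definition matching_family (G : sgraph) (K : finType) : Prop :=
  exists m : K -> G -> G, [/\ forall k x, adj x (m k x),
    forall k, involutive (m k) & forall k k', m k =1 m k' -> k = k'].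

Lemma matching_family_le (G : sgraph) (K : finType) :
  matching_family G K -> #|K| <= num_pm G.
Proof.
move=> [m [m_adj mK m_inj]].
pose M k := [set [set x; m k x] | x : G].
have ME k x : [set x; m k x] \in M k by apply/imsetP; exists x.
have M_edge k x A : A \in M k -> x \in A -> A = [set x; m k x].
  by case/imsetP => y _ -> /set2P[]->; rewrite ?mK // setUC.
have M_pm k : perfect_matching (M k).
  apply/andP; split; first by apply/subsetP => _ /imsetP[x _ ->]; rewrite edge_set2.
  apply/forallP => x; apply/cards1P; exists [set x; m k x].
  apply/setP => A; rewrite !inE; apply/andP/eqP => [[AM xA]|->]; first exact: M_edge.
  by rewrite ME !inE eqxx.
rewrite -(card_codom (f := M)) => [|k k' E].
  by apply: subset_leq_card; apply/subsetP => _ /codomP[k ->]; rewrite inE.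
apply: m_inj => x; have xM : [set x; m k x] \in M k' by rewrite -E ME.
have := M_edge _ x _ xM; rewrite !inE eqxx => /(_ isT)/setP/(_ (m k x)).
rewrite !inE eqxx orbT => /esym/orP[]/eqP // E'.
by have := m_adj k x; rewrite E' adj_irrefl.
Qed.

Lemma matching_family_iso (G H : sgraph) (K : finType) :
  isomorphic G H -> matching_family H K -> matching_family G K.
Proof.
move=> [f [f' fK f'K] f_adj] [m [m_adj mK m_inj]].
exists (fun k x => f' (m k (f x))); split => [k x|k x|k k' E].
- by rewrite -f_adj f'K.
- by rewrite f'K mK fK.
- by apply: m_inj => y; have := E (f' y); rewrite f'K => /(can_inj f'K).
Qed.

(** A matching is chosen independently in each component, so the family is indexed by dependent
    functions and the counts multiply. *)
Lemma matching_family_union (I : finType) (F : I -> sgraph) (k : I -> nat) :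
  (forall i, matching_family (F i) 'I_(k i)) ->
  matching_family (disjoint_union F) {dffun forall i, 'I_(k i)}.
Proof.
move=> /fin_all_exists[m mP].
exists (fun (c : {dffun forall i, 'I_(k i)}) (x : disjoint_union F) =>
  existT (fun i => vertex (F i)) (tag x) (m (tag x) (c (tag x)) (tagged x))).
split=> [c [i x]|c [i x]|c c' E] /=.
- by rewrite union_adjE; case: (mP i).
- by have [_ mK _] := mP i; rewrite mK.
- apply/ffunP => i; have [_ _ m_inj] := mP i; apply: m_inj => x.
  by have /eqP := E (existT _ i x); rewrite -tag_eqE /tag_eq /= eqxx /= tagged_asE => /eqP.
Qed.

(* Row [k] of a table maps each vertex to its partner in the [k]-th matching; the
   vertices of the cube are numbered by [cube_index], so that 0-1-2-3 and 4-5-6-7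
   are its two copies of [C_4]. *)
Definition K4_table : seq (seq nat) :=
  [:: [:: 1; 0; 3; 2]; [:: 2; 3; 0; 1]; [:: 3; 2; 1; 0]].

Definition cube_table : seq (seq nat) :=
  [:: [:: 4; 5; 6; 7; 0; 1; 2; 3];
      [:: 1; 0; 3; 2; 5; 4; 7; 6]; [:: 1; 0; 3; 2; 7; 6; 5; 4];
      [:: 3; 2; 1; 0; 5; 4; 7; 6]; [:: 3; 2; 1; 0; 7; 6; 5; 4];
      [:: 4; 5; 3; 2; 0; 1; 7; 6]; [:: 3; 5; 6; 0; 7; 1; 2; 4];
      [:: 1; 0; 6; 7; 5; 4; 2; 3]; [:: 4; 2; 1; 7; 0; 6; 5; 3]].

Definition ord_mod (n i : nat) : 'I_n.+1 := Ordinal (ltn_pmod i (ltn0Sn n)).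

Lemma K4_matchings : matching_family (complete_graph 4) 'I_3.
Proof.
exists (fun (k : 'I_3) (x : 'I_4) => ord_mod 3 (nth 0 (nth [::] K4_table k) x)); split.
- by move=> [[|[|[|//]]] hk] [[|[|[|[|//]]]] hx].
- by move=> [[|[|[|//]]] hk] [[|[|[|[|//]]]] hx]; apply: val_inj.
- move=> [[|[|[|//]]] hk] [[|[|[|//]]] hk'] /(_ ord0)/(congr1 val) //= _; exact: val_inj.
Qed.

Definition cube_vertex (i : nat) : cube := (ord_mod 3 i, ord_mod 1 (i %/ 4)).

Lemma cube_matchings : matching_family cube 'I_9.
Proof.
exists (fun (k : 'I_9) (x : cube) =>
  cube_vertex (nth 0 (nth [::] cube_table k) (cube_index x))); split.
- by move=> [[|[|[|[|[|[|[|[|[|//]]]]]]]]] hk] [[[|[|[|[|//]]]] hi] [[|[|//]] hj]].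
- move=> [[|[|[|[|[|[|[|[|[|//]]]]]]]]] hk] [[[|[|[|[|//]]]] hi] [[|[|//]] hj]];
  by apply/eqP.
(* The partners of the vertices 0, 2 and 4 already tell the nine rows of [cube_table] apart. *)
- move=> k k' E; have E0 := congr1 cube_index (E (cube_vertex 0)).
  have E2 := congr1 cube_index (E (cube_vertex 2)).
  have E4 := congr1 cube_index (E (cube_vertex 4)).
  case: k k' {E} E0 E2 E4 => [[|[|[|[|[|[|[|[|[|//]]]]]]]]] hk] [[|[|[|[|[|[|[|[|[|//]]]]]]]]] hk'];
  by move=> // *; apply: val_inj.
Qed.

Local Open Scope ring_scope.

(** * Hadamard's inequality *)

Section Hadamard.
Variable F : realFieldType.

Lemma dot_ge0 n (v : 'rV[F]_n) : 0 <= (v *m v^T) 0 0.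
Proof. by rewrite mxE sumr_ge0 // => j _; rewrite mxE -expr2 sqr_ge0. Qed.

Lemma dot_eq0 n (v : 'rV[F]_n) : (v *m v^T) 0 0 = 0 -> v = 0.
Proof.
rewrite mxE => /eqP; rewrite psumr_eq0 => [/allP v0|j _]; last first.
  by rewrite mxE -expr2 sqr_ge0.
apply/rowP => j; have := v0 j (mem_index_enum _).
by rewrite !mxE -expr2 sqrf_eq0 => /eqP.
Qed.

(** A null vector [w] of the Gram matrix of [B] satisfies [w *m B = 0], because the squared norm of
    [w *m B] vanishes; padded with a zero it is a null vector of the larger Gram matrix. *)
Lemma gram_det_singular m n (a : 'rV[F]_n) (B : 'M_(m, n)) :
  \det (B *m B^T) = 0 -> \det (col_mx a B *m (col_mx a B)^T) = 0.
Proof.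
move/eqP/det0P => [w w0 wC]; apply/eqP/det0P; exists (row_mx 0 w).
  by apply: contraNneq w0 => /(congr1 rsubmx); rewrite row_mxKr linear0 => ->.
have wB : w *m B = 0.
  by apply: dot_eq0; rewrite trmx_mul mulmxA -(mulmxA w) wC mul0mx mxE.
by rewrite mulmxA mul_row_col mul0mx add0r wB mul0mx.
Qed.

(* Here [y *m B] is the orthogonal projection of [a] on the rows of [B]. *)
Lemma gram_det_split m n (a : 'rV[F]_n) (B : 'M_(m, n)) :
  \det (B *m B^T) != 0 -> exists y : 'rV_m,
  [/\ \det (col_mx a B *m (col_mx a B)^T) =
        ((a - y *m B) *m (a - y *m B)^T) 0 0 * \det (B *m B^T),
      ((a - y *m B) *m (a - y *m B)^T) 0 0 =
        (a *m a^T) 0 0 - ((y *m B) *m (y *m B)^T) 0 0 &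
      a *m B^T = y *m B *m B^T].
Proof.
set C := B *m B^T => C0; have Cu : C \in unitmx by rewrite unitmxE unitfE.
pose y := a *m B^T *m invmx C.
have yC : y *m C = a *m B^T by rewrite mulmxKV.
have yBy : (y *m B) *m (y *m B)^T = a *m (y *m B)^T.
  by rewrite trmx_mul mulmxA -(mulmxA y) yC mulmxA.
have yBa : y *m B *m a^T = (y *m B) *m (y *m B)^T.
  have tr1 (x : 'M[F]_1) : x^T = x by apply/matrixP => i j; rewrite !ord1 mxE.
  by rewrite yBy -[RHS]tr1 trmx_mul trmxK.
have gramE : (a - y *m B) *m (a - y *m B)^T = a *m a^T - (y *m B) *m (y *m B)^T.
  by rewrite linearB /= mulmxBr !mulmxBl -yBy yBa subrr subr0.
exists y; split; last by rewrite -mulmxA.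
  rewrite gramE tr_col_mx mul_col_row -/C.
  set D := _ - _.
  (* Block elimination: [D] is the Schur complement of [C], and its entry is the squared distance
     from [a] to the row space of [B]. *)
  have -> : block_mx (a *m a^T) (a *m B^T) (B *m a^T) C =
      block_mx 1%:M y 0 1%:M *m block_mx D 0 (B *m a^T) C.
    rewrite mulmx_block !(mul0mx, mul1mx, mulmx0, add0r) yC mulmxA yBa.
    by rewrite /D subrK.
  by rewrite det_mulmx det_ublock !det1 !mul1r det_lblock det_mx11.
by rewrite gramE !mxE.
Qed.

(** Rows are added one at a time: each multiplies the Gram determinant by its squared distance to
    the span of the other rows, which is at most its squared norm. Rectangular matrices keep the
    induction going. Equality with a nonzero product forces every projection to vanish. *)
Theorem hadamard m n (A : 'M[F]_(m, n)) :
  0 <= \det (A *m A^T) <= \prod_i (A *m A^T) i i /\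
  (\det (A *m A^T) = \prod_i (A *m A^T) i i -> \prod_i (A *m A^T) i i != 0 ->
   forall i j, i != j -> (A *m A^T) i j = 0).
Proof.
elim: m A => [|m IH] A.
  by rewrite det_mx00 big_ord0 ler01 lexx; split=> // _ _ [].
rewrite -[m.+1]/(1 + m)%N in A *; rewrite -[A]vsubmxK.
set a := usubmx A; set B := dsubmx A; set M := col_mx a B *m _.
have [/andP[C0 CP] Ceq] := IH B; set C := B *m B^T in C0 CP Ceq.
have ME : M = block_mx (a *m a^T) (a *m B^T) (B *m a^T) C.
  by rewrite /M tr_col_mx mul_col_row.
have prodE : \prod_i M i i = (a *m a^T) 0 0 * \prod_i C i i.
  rewrite big_split_ord big_ord1 /= ME block_mxEul; congr (_ * _).
  by apply: eq_bigr => i _; rewrite block_mxEdr.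
have P0 : 0 <= \prod_i C i i by apply: le_trans CP.
have [D0|D0] := eqVneq (\det C) 0.
  have M0 : \det M = 0 by exact: gram_det_singular.
  rewrite M0 prodE lexx mulr_ge0 ?dot_ge0 //; split=> // <-; by rewrite eqxx.
have [y [detM qE aB]] := gram_det_split a D0.
rewrite -/M -/C in detM; set q := (_ *m _) 0 0 in detM qE.
have q0 : 0 <= q := dot_ge0 _.
have qa : q <= (a *m a^T) 0 0 by rewrite qE lerBlDr lerDl dot_ge0.
split; first by rewrite detM prodE mulr_ge0 //= ler_pM.
rewrite detM prodE => E; rewrite mulf_eq0 negb_or => /andP[a0 CP0].
have Cp : 0 < \det C by rewrite lt_def D0.
have Pp : 0 < \prod_i C i i by rewrite lt_def CP0.
have ap : 0 < (a *m a^T) 0 0 by rewrite lt_def a0 dot_ge0.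
(* Two products of positive factors agree while the factors are ordered termwise, so the factors
   agree. *)
have CE : \det C = \prod_i C i i.
  apply/eqP; rewrite eq_le CP /= -(ler_pM2l ap) -E ler_wpM2r //.
have qa' : q = (a *m a^T) 0 0 by apply: (mulIf CP0); rewrite -{1}CE.
have yB0 : y *m B = 0 by apply: dot_eq0; lra.
have aB0 : a *m B^T = 0 by rewrite aB yB0 mul0mx.
have Ba0 : B *m a^T = 0 by apply: trmx_inj; rewrite trmx_mul trmxK aB0 linear0.
have Cd := Ceq CE CP0.
move=> i j; rewrite ME aB0 Ba0.
case: (split_ordP i) => i' ->; case: (split_ordP j) => j' ->.
- by rewrite !ord1 eqxx.
- by rewrite block_mxEur mxE.
- by rewrite block_mxEdl mxE.
- by rewrite block_mxEdr (inj_eq (@rshift_inj _ _)); exact: Cd.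
Qed.
End Hadamard.

(** * Determinants of skew adjacency matrices of regular graphs *)

Definition skew_entry (G : sgraph) (o : rel G) (u v : G) : int :=
  if o u v then 1 else if o v u then -1 else 0.

Lemma skew_entryP (G : sgraph) (o : rel G) u v : orientation o ->
  if adj u v then skew_entry o u v = 1 \/ skew_entry o u v = -1
  else skew_entry o u v = 0.
Proof.
move=> oP; rewrite /skew_entry; have [ouv oadj] := oP u v.
case: ifPn => uv.
  by case: (boolP (o u v)) => [_|]; [left|rewrite ouv // negbK => ->; right].
case: ifPn => [/oadj|_]; first by rewrite (negbTE uv).
case: ifPn => // /(oP v u).2; by rewrite adj_sym (negbTE uv).
Qed.

Lemma skew_gram (G : sgraph) (o : rel G) i j :
  (skew_adj_mx o *m (skew_adj_mx o)^T) i j =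
  \sum_w skew_entry o (enum_val i) w * skew_entry o (enum_val j) w.
Proof.
rewrite mxE [RHS](reindex (@enum_val G G)) /=; last exact/onW_bij/enum_val_bij.
by apply: eq_bigr => k _; rewrite !mxE.
Qed.

Lemma skew_gram_diag (G : sgraph) (o : rel G) d i : regular d G -> orientation o ->
  (skew_adj_mx o *m (skew_adj_mx o)^T) i i = d%:R.
Proof.
move=> Gd oP; rewrite skew_gram -(Gd (enum_val i)) -sum1dep_card natr_sum [RHS]big_mkcond /=.
apply: eq_bigr => w _; have := skew_entryP (enum_val i) w oP.
by case: ifP => _; [case|] => ->.
Qed.

(** Each common neighbour contributes 1 or -1 to the sum and every other vertex 0. A zero sum has as
    many terms -1 as terms 1, so the common neighbours number twice [#|N|]. *)
Lemma common_nbrs_even (G : sgraph) (o : rel G) u v : orientation o ->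
  \sum_w skew_entry o u w * skew_entry o v w = 0 -> ~~ odd #|common_nbrs u v|.
Proof.
move=> oP s0; pose N := [set w | skew_entry o u w * skew_entry o v w == -1].
suff -> : #|common_nbrs u v| = (2 * #|N|)%N by rewrite oddM.
apply/eqP; rewrite -(eqr_nat int) /common_nbrs /N -!sum1dep_card natrM !natr_sum.
rewrite mulr_sumr -[X in X == _]subr0 -[X in _ - X]s0.
rewrite [X in X - _]big_mkcond [X in _ == X]big_mkcond /=.
rewrite -sumrB; apply/eqP; apply: eq_bigr => w _.
have := skew_entryP u w oP; have := skew_entryP v w oP.
by case: (adj u w); case: (adj v w) => /=; do 2![move=> -> || case=> ->].
Qed.

(** The square of the determinant is a Gram determinant with constant diagonal [d]. Hadamard's
    inequality is applied over [rat], where projections exist, and orthogonality of the rows is read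
    back in [int]. *)
Lemma regular_det_le (G : sgraph) (o : rel G) d : regular d G -> orientation o ->
  \det (skew_adj_mx o) ^+ 2 <= d%:R ^+ #|G| /\
  (\det (skew_adj_mx o) ^+ 2 = d%:R ^+ #|G| -> (0 < d)%N ->
   forall u v : G, u != v -> ~~ odd #|common_nbrs u v|).
Proof.
move=> Gd oP; set S := skew_adj_mx o; pose SQ : 'M[rat]_#|G| := map_mx intr S.
have gramE i j : (SQ *m SQ^T) i j = ((S *m S^T) i j)%:~R.
  by rewrite map_trmx -map_mxM mxE.
have detE : \det (SQ *m SQ^T) = (\det S ^+ 2)%:~R.
  by rewrite det_mulmx det_tr det_map_mx -expr2 rmorphXn.
have prodE : \prod_i (SQ *m SQ^T) i i = (d%:R ^+ #|G| : int)%:~R.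
  under eq_bigr do rewrite gramE (skew_gram_diag _ Gd oP).
  by rewrite prodr_const card_ord rmorphXn.
have [/andP[_]] := hadamard SQ; rewrite detE prodE ler_int => le eqH; split=> // E d0.
move=> u v uv; apply: (common_nbrs_even oP).
have := eqH; rewrite E => /(_ erefl); rewrite intr_eq0 expf_eq0 pnatr_eq0.
rewrite -[d == 0]negbK -lt0n d0 andbF => /(_ isT (enum_rank u) (enum_rank v)).
rewrite (inj_eq enum_rank_inj) => /(_ uv) /eqP.
by rewrite gramE intr_eq0 skew_gram !enum_rankK => /eqP.
Qed.

(** * The square of the Pfaffian *)

Section PfaffianSum.
Variable R : comPzRingType.
Variable m : nat.

(* This is [2 ^ m * m`!] times the Pfaffian: each set of pairs is listed by
   [2 ^ m * m`!] permutations. *)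
Definition pfaffian_sum (A : 'M[R]_(m + m)) : R :=
  \sum_(s : 'S_(m + m)) (-1) ^+ s * \prod_(i < m) A (s (lshift m i)) (s (rshift m i)).

(** As for the product rule of determinants, the sum is expanded over all maps [f] of the positions.
    A map that is not injective gives a determinant with two equal rows; a permutation gives
    [\det B] up to its sign. *)
Lemma pfaffian_sum_congr (B A : 'M[R]_(m + m)) :
  pfaffian_sum (B *m A *m B^T) = \det B * pfaffian_sum A.
Proof.
pose l := @lshift m m; pose r := @rshift m m.
pose Fn := {ffun 'I_(m + m) -> 'I_(m + m)}.
pose w (f : Fn) := \prod_(i < m) A (f (l i)) (f (r i)).
have expand (s : 'S_(m + m)) :
    \prod_(i < m) (B *m A *m B^T) (s (l i)) (s (r i)) =
    \sum_(f : Fn) w f * \prod_x B (s x) (f x).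
  pose G i (kl : 'I_(m + m) * 'I_(m + m)) :=
    A kl.1 kl.2 * (B (s (l i)) kl.1 * B (s (r i)) kl.2).
  transitivity (\prod_(i < m) \sum_kl G i kl).
    apply: eq_bigr => i _; rewrite mxE -(pair_bigA _ (fun k k' => G i (k, k'))) /=.
    rewrite exchange_big /=; apply: eq_bigr => k' _; rewrite !mxE mulr_suml.
    by apply: eq_bigr => k _; rewrite /G /=; ring.
  rewrite bigA_distr_bigA /=.
  (* Choosing a pair of indices for every [i] amounts to choosing one map on all [m + m]
     positions. *)
  pose join (g : {ffun 'I_m -> 'I_(m + m) * 'I_(m + m)}) : Fn :=
    [ffun x => match split x with inl i => (g i).1 | inr i => (g i).2 end].
  pose cut (f : Fn) := [ffun i => (f (l i), f (r i))].
  have joinl g i : join g (l i) = (g i).1 by rewrite ffunE (unsplitK (inl i)).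
  have joinr g i : join g (r i) = (g i).2 by rewrite ffunE (unsplitK (inr i)).
  rewrite (reindex cut) /=; last first.
    exists join => [f _|g _]; apply/ffunP => x.
      rewrite ffunE; case: splitP => j xj; rewrite ffunE /=; congr (f _); exact: val_inj.
    by rewrite ffunE joinl joinr; case: (g x).
  apply: eq_bigr => f _; rewrite big_split_ord /= -big_split /w -big_split /=.
  by apply: eq_bigr => i _; rewrite /G !ffunE.
pose D (f : Fn) := \sum_(s : 'S_(m + m)) (-1) ^+ s * \prod_x B (s x) (f x).
have -> : pfaffian_sum (B *m A *m B^T) = \sum_(f : Fn) w f * D f.
  rewrite /pfaffian_sum; under eq_bigr do rewrite expand mulr_sumr.
  rewrite exchange_big /=; apply: eq_bigr => f _; rewrite mulr_sumr.
  by apply: eq_bigr => s _; rewrite mulrCA.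
have DE f : D f = \det (\matrix_(x, y) B y (f x)).
  by apply: eq_bigr => s _; congr (_ * _); apply: eq_bigr => x _; rewrite mxE.
rewrite (bigID (fun f : Fn => injectiveb f)) /= addrC big1 ?add0r => [|f Uf]; last first.
  case/injectivePn: Uf => i1 [i2 Di12 Ef12].
  by rewrite DE (determinant_alternate Di12) ?mulr0 //= => j; rewrite !mxE Ef12.
rewrite (reindex (@pval _)) /=; last first.
  pose in_Sn := insubd (1%g : 'S_(m + m)).
  by exists in_Sn => /= f Uf; first apply: val_inj; apply: insubdK.
rewrite mulr_sumr; apply: eq_big => /= [s | s _]; rewrite ?(valP s) //.
have -> : D (pval s) = (-1) ^+ s * \det B.
  rewrite DE (_ : \matrix_(_, _) _ = row_perm s B^T).
    by rewrite row_permE det_mulmx det_perm det_tr.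
  by apply/matrixP => x y; rewrite !mxE pvalE.
have -> : w (pval s) = \prod_(i < m) A (s (l i)) (s (r i)).
  by apply: eq_bigr => i _; rewrite !pvalE.
have rev3 (x y z : R) : x * (y * z) = z * (y * x) by rewrite mulrC (mulrC y) -mulrA.
exact: rev3.
Qed.

End PfaffianSum.

(** * Symplectic bases and Cayley's identity *)

Section SymplecticBasis.
Variables (F : numFieldType).

Definition symplectic_mx m : 'M[F]_(m + m) := block_mx 0 1%:M (- 1%:M) 0.

Lemma pfaffian_sum_singular m (A : 'M[F]_(m + m)) :
  A^T = - A -> \det A = 0 -> pfaffian_sum A = 0.
Proof.
move=> AT A0.
(* Congruence by a singular [B] with [B *m A = A] multiplies the sum by 0. *)
have [B BA B0] : exists2 B : 'M_(m + m), B *m A = A & \det B = 0.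
  by exists (A *m pinvmx A); [exact: mulmxKpV | rewrite det_mulmx A0 mul0r].
have ABT : A *m B^T = A.
  by rewrite -[A]opprK -AT mulNmx -trmx_mul BA.
by rewrite -[A]ABT -[A in A *m _]BA pfaffian_sum_congr B0 mul0r.
Qed.

Lemma skew_form0 n (A : 'M[F]_n) (u : 'rV_n) : A^T = - A -> u *m A *m u^T = 0.
Proof.
move=> AT; set x := u *m A *m u^T.
have : x^T = - x by rewrite /x !trmx_mul trmxK AT mulNmx mulmxN mulmxA.
move: x => x /matrixP/(_ 0 0); rewrite !mxE => /eqP.
rewrite -addr_eq0 -mulr2n mulrn_eq0 /= => /eqP x0.
by apply/matrixP => i j; rewrite !ord1 x0 mxE.
Qed.

(** One step of symplectic Gram-Schmidt. The vectors orthogonal for [A] to the rows of [U] and [V]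
    form a nonzero space as [m + m < n]; [u] is taken there and paired with a vector [z] by
    nondegeneracy. *)
Lemma symplectic_extend n m (A : 'M[F]_n) (U V : 'M_(m, n)) :
  A^T = - A -> A \in unitmx -> (m + m < n)%N ->
  U *m A *m U^T = 0 -> V *m A *m V^T = 0 -> U *m A *m V^T = 1%:M ->
  exists u v : 'rV_n,
   [/\ u *m A *m v^T = 1%:M, u *m A *m U^T = 0, u *m A *m V^T = 0,
      v *m A *m U^T = 0 & v *m A *m V^T = 0].
Proof.
move=> AT Au mn UU VV UV.
have VU : V *m A *m U^T = - 1%:M.
  by apply: trmx_inj; rewrite !trmx_mul trmxK AT mulNmx mulmxN mulmxA UV linearN /= trmx1.
pose W := col_mx U V.
have : kermx (A *m W^T) != 0.
  rewrite kermx_eq0 /row_free; apply: contraTneq mn => <-; rewrite -leqNgt.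
  exact: rank_leq_col.
move=> /rowV0Pn[u /sub_kermxP uW u0].
have uU : u *m A *m U^T = 0 /\ u *m A *m V^T = 0.
  move: uW; rewrite mulmxA /W tr_col_mx mul_mx_row => /eqP.
  by rewrite row_mx_eq0 => /andP[/eqP-> /eqP->].
have uA : u *m A != 0.
  by apply: contraNneq u0 => uA; rewrite -(mulmxK Au u) uA mul0mx.
have [z uz] : exists z : 'rV_n, u *m A *m z^T = 1%:M.
  case/rV0Pn: uA => j uj; exists (((u *m A) 0 j)^-1 *: delta_mx 0 j).
  move: (u *m A) uj => y yj; apply/matrixP => i k.
  rewrite !ord1 [(_ *: _)^T]linearZ /= trmx_delta -scalemxAr -colE !mxE.
  by rewrite mulVf.
(* This removes from [z] its component along [U] and [V]; the pairing with [u] is kept since [u] is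
   orthogonal to both. *)
pose v := z - (z *m A *m V^T) *m U + (z *m A *m U^T) *m V.
exists u, v; rewrite uU.1 uU.2; split=> //.
- rewrite /v [(_ + _)^T]linearD /= [(_ - _)^T]linearB /=.
  rewrite ![(_ *m U)^T]trmx_mul ![(_ *m V)^T]trmx_mul mulmxDr mulmxBr.
  by rewrite uz !mulmxA uU.1 uU.2 !mul0mx subr0 addr0.
- rewrite /v !mulmxDl !mulNmx -!(mulmxA _ A) -!(mulmxA _ U) -!(mulmxA _ V) !(mulmxA _ A).
  by rewrite UU VU mulmx0 subr0 mulmxN mulmx1 subrr.
- rewrite /v !mulmxDl !mulNmx -!(mulmxA _ A) -!(mulmxA _ U) -!(mulmxA _ V) !(mulmxA _ A).
  by rewrite VV UV mulmx0 addr0 mulmx1 subrr.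
Qed.

Lemma symplectic_basis n m (A : 'M[F]_n) :
  A^T = - A -> A \in unitmx -> (m + m <= n)%N ->
  exists U V : 'M_(m, n),
    [/\ U *m A *m U^T = 0, V *m A *m V^T = 0 & U *m A *m V^T = 1%:M].
Proof.
move=> AT Au; elim: m => [|m IH] mn.
  by exists 0, 0; split; apply/matrixP => - [].
have mn1 : (m + m < n)%N by apply: leq_trans mn; rewrite addSn addnS.
have [U [V [UU VV UV]]] := IH (ltnW mn1).
have [u [v [uv uU uV vU vV]]] := symplectic_extend AT Au mn1 UU VV UV.
have anti p q (X : 'M_(p, n)) (Y : 'M_(q, n)) : X *m A *m Y^T = 0 -> Y *m A *m X^T = 0.
  move=> XY; apply: trmx_inj; rewrite !trmx_mul trmxK AT mulNmx mulmxN mulmxA XY.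
  by rewrite oppr0 trmx0.
rewrite -[m.+1]/(1 + m)%N; exists (col_mx u U), (col_mx v V).
rewrite !tr_col_mx !mul_col_mx !mul_mx_row.
rewrite !(skew_form0 _ AT) UU VV UV uv uU uV vV.
rewrite !(anti _ _ _ _ uU, anti _ _ _ _ vV, anti _ _ _ _ vU).
by split; rewrite ?row_mx0 ?col_mx0 ?scalar_mx_block // -block_mxEh.
Qed.

Lemma det_symplectic m : \det (symplectic_mx m) = 1.
Proof.
pose X : 'M[F]_(m + m) := block_mx 1%:M 1%:M 0 1%:M.
pose Y : 'M[F]_(m + m) := block_mx 1%:M 0 (- 1%:M) 1%:M.
have -> : symplectic_mx m = X *m Y *m X.
  rewrite /X /Y !mulmx_block !(mul0mx, mulmx0, mul1mx, mulmx1, addr0, add0r).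
  by rewrite subrr !(mul0mx, mulmx1, add0r) addNr.
by rewrite !det_mulmx /X /Y det_ublock det_lblock !det1 !mulr1.
Qed.

(** Congruence by a symplectic basis [W] turns [A] into the standard form, multiplies the Pfaffian
    sum by [\det W] and the determinant by its square. If [A] is singular both sides vanish. The
    last factor is the squared normalization constant of [pfaffian_sum]. *)
Lemma pfaffian_sum_sqr m (A : 'M[F]_(m + m)) : A^T = - A ->
  pfaffian_sum A ^+ 2 = \det A * pfaffian_sum (symplectic_mx m) ^+ 2.
Proof.
move=> AT; have [A0|A0] := eqVneq (\det A) 0.
  by rewrite (pfaffian_sum_singular AT A0) A0 mul0r expr0n.
have Au : A \in unitmx by rewrite unitmxE unitfE.
have [U [V [UU VV UV]]] := symplectic_basis AT Au (leqnn _).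
pose W := col_mx U V.
have VU : V *m A *m U^T = - 1%:M.
  by apply: trmx_inj; rewrite !trmx_mul trmxK AT mulNmx mulmxN mulmxA UV linearN /= trmx1.
have WJ : W *m A *m W^T = symplectic_mx m.
  by rewrite /W tr_col_mx mul_col_mx mul_col_row UU VV UV VU.
have : \det W ^+ 2 * \det A = 1.
  have := det_symplectic m; rewrite -WJ !det_mulmx det_tr => <-.
  by rewrite expr2 mulrAC.
rewrite -WJ pfaffian_sum_congr exprMn mulrCA mulrA [_ * \det A]mulrC => ->.
by rewrite mul1r.
Qed.

End SymplecticBasis.

Lemma det_relabel (R : comPzRingType) (T : finType) n1 n2
    (f1 : 'I_n1 -> T) (f2 : 'I_n2 -> T) (k : T -> T -> R) :
  bijective f1 -> bijective f2 ->
  \det (\matrix_(i, j) k (f1 i) (f1 j)) = \det (\matrix_(i, j) k (f2 i) (f2 j)).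
Proof.
move=> b1 b2; have E : n1 = n2.
  by rewrite -(card_ord n1) -(card_ord n2) (bij_eq_card b1) (bij_eq_card b2).
subst n2; have [g2 f2K g2K] := b2.
have s_inj : injective (g2 \o f1) := inj_comp (can_inj g2K) (bij_inj b1).
have -> : \matrix_(i, j) k (f1 i) (f1 j) =
    row_perm (perm s_inj) (col_perm (perm s_inj) (\matrix_(i, j) k (f2 i) (f2 j))).
  by apply/matrixP => i j; rewrite !mxE !permE /= !g2K.
rewrite row_permE col_permE !det_mulmx !det_perm odd_permV.
by rewrite mulrCA -expr2 sqrr_sign mulr1.
Qed.

(** A term is nonzero only for a permutation that preserves the pairs, and no term exceeds 1 in
    absolute value. This bounds the normalization constant. *)
Lemma pfaffian_sum_symplectic_le m :
  `|pfaffian_sum (symplectic_mx rat m)| <= #|pair_stabilizer m|%:R.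
Proof.
have Jpair (a b : 'I_(m + m)) : symplectic_mx rat m a b != 0 ->
    exists j, [set a; b]%SET = [set lshift m j; rshift m j]%SET.
  case: (split_ordP a) => i ->; case: (split_ordP b) => j ->;
  rewrite ?(block_mxEul, block_mxEur, block_mxEdl, block_mxEdr) !mxE ?eqxx //.
    by case: (eqVneq i j) => [->|_]; rewrite ?eqxx //; exists j.
  by case: (eqVneq i j) => [->|_]; rewrite ?oppr0 ?eqxx //; exists j; rewrite finset.setUC.
have Jle (a b : 'I_(m + m)) : `|symplectic_mx rat m a b| <= 1.
  case: (split_ordP a) => i ->; case: (split_ordP b) => j ->;
  rewrite ?(block_mxEul, block_mxEur, block_mxEdl, block_mxEdr) !mxE ?normr0 //;
  by rewrite ?normrN; case: (eqVneq i j); rewrite ?normr1 ?normr0.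
apply: le_trans (ler_norm_sum _ _ _) _.
rewrite -sum1_card natr_sum [leRHS]big_mkcond /=; apply: ler_sum => s _.
rewrite normrM normrX normrN1 expr1n mul1r normr_prod.
case: ifPn => [_|]; first by apply: prodr_ile1 => i _; rewrite normr_ge0 Jle.
rewrite inE negb_forall => /existsP[i iN].
rewrite (bigD1 i) //= (_ : symplectic_mx _ _ _ _ = 0) ?normr0 ?mul0r //.
apply/eqP; apply: contraNT iN => /Jpair[j E].
by apply/existsP; exists j; apply/eqP.
Qed.

Lemma pair_stabilizer_gt0 m : (0 < #|pair_stabilizer m|)%N.
Proof.
apply/card_gt0P; exists 1%g; rewrite inE; apply/forallP => i; apply/existsP.
by exists i; rewrite !perm1.
Qed.

Definition signed_orientation (G : sgraph) (s : G -> G -> rat) : rel G :=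
  fun u v => adj u v && (s u v == 1).

(** By the last hypothesis all listings count with the same sign [K], so nothing cancels: the
    Pfaffian sum is [K] times the number of listings. Squaring it and dividing by the square of the
    order of the stabilizer leaves the bound. *)
Lemma num_pm_sqr_le_det (G : sgraph) m (e : 'I_(m + m) -> G) (s : G -> G -> rat)
    (K : rat) :
  bijective e -> (forall u v, adj u v -> s v u = - s u v) ->
  (forall u v, s u v ^+ 2 = 1) -> K ^+ 2 = 1 ->
  (forall t : 'S_(m + m), lists_edges e t ->
     (-1) ^+ t * \prod_i s (e (t (lshift m i))) (e (t (rshift m i))) = K) ->
  (num_pm G)%:R ^+ 2 <= `|\det (skew_adj_mx (signed_orientation s))|.
Proof.
move=> e_bij sN s2 K2 sK; set o := signed_orientation s.
pose k u v : int := if o u v then 1 else if o v u then -1 else 0.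
have -> : \det (skew_adj_mx o) = \det (\matrix_(i, j) k (e i) (e j)).
  apply: det_relabel => //; exact: enum_val_bij.
set S := \matrix_(i, j) k (e i) (e j).
have sE u v : s u v = 1 \/ s u v = -1.
  have /eqP := s2 u v; rewrite sqrf_eq1 => /orP[]/eqP; [by left|by right].
have kE u v : (k u v)%:~R = (if adj u v then s u v else 0) :> rat.
  rewrite /k /o /signed_orientation (adj_sym v); case: (boolP (adj u v)) => //= uv.
  by rewrite (sN u v uv); have [->|->] := sE u v; rewrite ?opprK ?eqxx.
have ST : (map_mx intr S : 'M[rat]_(m + m))^T = - map_mx intr S.
  apply/matrixP => i j; rewrite !mxE !kE adj_sym; case: ifP => [ij|_].
    by rewrite sN // adj_sym.
  by rewrite oppr0.
set N := num_pm G; set h := #|pair_stabilizer m|.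
have pfS : pfaffian_sum (map_mx intr S) = K * (N * h)%:R :> rat.
  rewrite -(card_listings e_bij) -sum1_card natr_sum mulr_sumr big_mkcond /=.
  apply: eq_bigr => t _; rewrite inE; case: ifPn => [te|].
    rewrite mulr1 -(sK t te); congr (_ * _); apply: eq_bigr => i _.
    by rewrite !mxE kE (forallP te).
  rewrite negb_forall => /existsP[i /negbTE iN].
  by rewrite (bigD1 i) //= !mxE kE iN mul0r mulr0.
have := pfaffian_sum_sqr ST; rewrite pfS exprMn K2 mul1r natrM exprMn.
have h0 : 0 < h%:R ^+ 2 :> rat by rewrite exprn_gt0 // ltr0n pair_stabilizer_gt0.
rewrite det_map_mx => E; rewrite -(ler_int rat) -(ler_pM2r h0).
rewrite rmorphXn /= intr_norm.
rewrite rmorph_nat E; apply: le_trans (ler_norm _) _.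
rewrite normrM ler_wpM2l // normrX lerXn2r ?nnegrE //.
exact: pfaffian_sum_symplectic_le.
Qed.

Lemma signed_orientationP (G : sgraph) (s : G -> G -> rat) :
  (forall u v, adj u v -> s v u = - s u v) -> (forall u v, s u v ^+ 2 = 1) ->
  orientation (signed_orientation s).
Proof.
move=> sN s2 u v; split=> [uv|/andP[]//].
rewrite /signed_orientation (adj_sym v) uv /= (sN u v uv).
by have /eqP := s2 u v; rewrite sqrf_eq1 => /orP[]/eqP->; rewrite ?opprK ?eqxx.
Qed.

(** * Signs of perfect matchings *)

Section Tournaments.
Variables (R : comPzRingType) (T : finType).

Definition tournament (r : rel T) :=
  irreflexive r /\ forall i j, i != j -> r j i = ~~ r i j.

(** The common arcs contribute equally; the remaining arcs of [r] are those of [r'] reversed, which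
    a symmetric [f] does not notice. *)
Lemma tournament_prod (r r' : rel T) (f : T -> T -> R) :
  tournament r -> tournament r' -> (forall i j, f i j = f j i) ->
  \prod_i \prod_(j | r i j) f i j = \prod_i \prod_(j | r' i j) f i j.
Proof.
move=> [rI rT] [r'I r'T] fC.
pose S (P : rel T) := \prod_i \prod_(j | P i j) f i j.
have SC (P : rel T) : S P = S (fun i j => P j i).
  rewrite /S (exchange_big_dep xpredT) //=; apply: eq_bigr => i _.
  by apply: eq_bigr => j _.
have SID (P Q : rel T) : S P = S (fun i j => P i j && Q i j) * S (fun i j => P i j && ~~ Q i j).
  by rewrite /S -big_split /=; apply: eq_bigr => i _; rewrite (bigID (Q i)).
have Seq (P Q : rel T) : P =2 Q -> S P = S Q.
  by move=> PQ; apply: eq_bigr => i _; apply: eq_bigl => j; rewrite PQ.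
rewrite -!/(S _) (SID r r') (SID r' r); congr (_ * _).
  by apply: Seq => i j; rewrite andbC.
rewrite SC; apply: Seq => i j.
have [->|ij] := eqVneq i j; first by rewrite rI r'I.
by rewrite (rT _ _ ij) (r'T _ _ ij) negbK andbC.
Qed.

End Tournaments.

Lemma ltn_ord_tournament n : tournament (fun i j : 'I_n => (i < j)%N).
Proof.
split=> [i|i j ij]; first exact: ltnn.
by rewrite -leqNgt ltn_neqAle eq_sym -(inj_eq val_inj) in ij *; rewrite ij.
Qed.

Section PermSign.
Variables (F : numFieldType) (n : nat).
Implicit Type s : 'S_n.

(** Permuting the columns of a Vandermonde matrix multiplies its determinant by the sign. *)
Lemma perm_sign_natr s :
  \prod_(i < n) \prod_(j < n | (i < j)%N) ((s j)%:R - (s i)%:R : F) =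
  (-1) ^+ s * \prod_(i < n) \prod_(j < n | (i < j)%N) (j%:R - i%:R).
Proof.
have := det_Vandermonde (\row_(j < n) (s j : nat)%:R : 'rV[F]_n).
have -> : Vandermonde n (\row_(j < n) (s j : nat)%:R : 'rV[F]_n) =
    col_perm s (Vandermonde n (\row_(j < n) (j : nat)%:R)).
  by apply/matrixP => i j; rewrite !mxE.
rewrite col_permE det_mulmx det_perm odd_permV det_Vandermonde mulrC.
under eq_bigr do under eq_bigr do rewrite !mxE.
by move=> ->; apply: eq_bigr => i _; apply: eq_bigr => j _; rewrite !mxE.
Qed.

(* Dividing [f] by the Vandermonde factors leaves a symmetric function, whose
   product over unordered pairs is invariant under [s]. *)
Lemma perm_sign_antisym s (f : 'I_n -> 'I_n -> F) :
  (forall i j, i != j -> f j i = - f i j) ->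
  \prod_(i < n) \prod_(j < n | (i < j)%N) f (s i) (s j) =
  (-1) ^+ s * \prod_(i < n) \prod_(j < n | (i < j)%N) f i j.
Proof.
move=> fN; pose h (i j : 'I_n) : F := j%:R - i%:R.
pose g i j := f i j / h i j.
have gC i j : g i j = g j i.
  rewrite /g /h; have [->//|ij] := eqVneq i j.
  by rewrite (fN _ _ ij) -opprB invrN mulrN mulNr.
have fE i j : i != j -> f i j = h i j * g i j.
  move=> ij; rewrite /g mulrC divfK // /h subr_eq0 eqr_nat.
  by rewrite eq_sym (inj_eq val_inj).
have ltP (i j : 'I_n) : (i < j)%N -> i != j by move=> ij; rewrite -(inj_eq val_inj) ltn_eqF.
transitivity (\prod_(i < n) \prod_(j < n | (i < j)%N) (h (s i) (s j) * g (s i) (s j))).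
  apply: eq_bigr => i _; apply: eq_bigr => j ij; apply: fE.
  by rewrite (inj_eq perm_inj) ltP.
under eq_bigr do rewrite big_split; rewrite big_split /= perm_sign_natr -mulrA; congr (_ * _).
transitivity (\prod_(i < n) \prod_(j < n | (i < j)%N) (h i j * g i j)); last first.
  by apply: eq_bigr => i _; apply: eq_bigr => j ij; rewrite fE ?ltP.
under [RHS]eq_bigr do rewrite big_split; rewrite big_split /=; congr (_ * _).
have lt1 := ltn_ord_tournament n.
pose r (i j : 'I_n) := ((s^-1)%g i < (s^-1)%g j)%N.
rewrite (tournament_prod (r' := r) lt1 _ gC); last first.
  split=> [i|i j ij]; first exact: ltnn.
  by rewrite /r lt1.2 // (inj_eq perm_inj).
rewrite [RHS](reindex_perm s) /=; apply: eq_bigr => i _.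
rewrite [RHS](reindex_perm s) /=; apply: eq_bigl => j.
by rewrite /r !permK.
Qed.

End PermSign.

Lemma prod_off_diag (R : comPzRingType) m (g : 'I_m -> 'I_m -> R) :
  \prod_i \prod_(j | j != i) g i j =
  \prod_(i < m) \prod_(j < m | (i < j)%N) (g i j * g j i).
Proof.
under [RHS]eq_bigr do rewrite big_split; rewrite big_split /=.
rewrite [X in _ = _ * X](exchange_big_dep xpredT) //= -big_split /=.
apply: eq_bigr => i _; rewrite (bigID (fun j : 'I_m => (i < j)%N)) /=.
by congr (_ * _); apply: eq_bigl => j; rewrite -(inj_eq val_inj) /=; case: ltngtP.
Qed.

(** Two positions either form one of the pairs [i], [m + i] or belong to two different pairs; for
    [i < j] the latter give four factors, in the last of which the arguments come from [j] and then
    [i]. *)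
Lemma prod_pairs_split (R : comPzRingType) m (f : 'I_(m + m) -> 'I_(m + m) -> R) :
  \prod_(a < m + m) \prod_(b < m + m | (a < b)%N) f a b =
  \prod_i f (lshift m i) (rshift m i) *
  \prod_(i < m) \prod_(j < m | (i < j)%N)
    (f (lshift m i) (lshift m j) * f (rshift m i) (rshift m j) *
     (f (lshift m i) (rshift m j) * f (lshift m j) (rshift m i))).
Proof.
under [X in _ = _ * X]eq_bigr do rewrite big_split; rewrite big_split /=.
rewrite -(prod_off_diag (fun i j => f (lshift m i) (rshift m j))).
rewrite mulrCA -[X in _ = _ * X]big_split /=.
under [X in _ = X * _]eq_bigr do rewrite big_split; rewrite big_split /=.
rewrite big_split_ord /= mulrAC -[X in _ = X * _]big_split /=; congr (_ * _).
  apply: eq_bigr => i _; rewrite big_split_ord /=; congr (_ * _).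
  rewrite (bigD1 i) /= ?(leq_trans (ltn_ord i)) ?leq_addr //; congr (_ * _).
  apply: eq_bigl => j; rewrite (leq_trans (ltn_ord i)) ?leq_addr //.
apply: eq_bigr => i _; rewrite big_split_ord /= big_pred0 ?mul1r.
  by apply: eq_bigl => j; rewrite ltn_add2l.
by move=> j; apply/negbTE; rewrite -leqNgt (leq_trans (ltnW (ltn_ord j))) ?leq_addr.
Qed.

Section MatchingSign.
Variables (T : finType) (m : nat) (e : 'I_(m + m) -> T) (adj L : rel T).
(* [L] is the lexicographic order of the vertices in the plane and [phi A v] says
   that [v] lies below an odd number of the pieces of the arc [A]. *)
Variable phi : {set T} -> T -> bool.
Hypothesis e_bij : bijective e.
Hypothesis L_tournament : tournament L.
Hypothesis parity : forall a b c d, adj a b -> adj c d ->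
  [disjoint [set a; b] & [set c; d]] ->
  L a c (+) L b c (+) (L a d (+) L b d) =
  phi [set a; b] c (+) phi [set a; b] d (+) (phi [set c; d] a (+) phi [set c; d] b).

Definition order_sign (u v : T) : rat := (-1) ^+ (L v u).
Definition edge_weight (A : {set T}) : rat := \prod_(v | v \notin A) (-1) ^+ phi A v.
Definition edge_sign u v := order_sign u v * edge_weight [set u; v].

(** The sign of [s] compares the product of order signs over all pairs of positions before and after
    [s]. Matched pairs yield the order signs of the edges. By [parity], the four cross pairs of two
    edges yield factors that regroup into edge weights. What remains is [E], the product before [s],
    and [C], one -1 per pair of edges. *)
Lemma matching_sign : exists2 K : rat, K ^+ 2 = 1 & forall s : 'S_(m + m),
  (forall i, adj (e (s (lshift m i))) (e (s (rshift m i)))) ->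
  (-1) ^+ s * \prod_i edge_sign (e (s (lshift m i))) (e (s (rshift m i))) = K.
Proof.
have e_inj := bij_inj e_bij.
pose E : rat := \prod_(a < m + m) \prod_(b < m + m | (a < b)%N) order_sign (e a) (e b).
pose C : rat := \prod_(i < m) \prod_(j < m | (i < j)%N) -1.
have sqp (I : finType) (P : pred I) (F : I -> rat) :
    (forall i, P i -> F i ^+ 2 = 1) -> (\prod_(i | P i) F i) ^+ 2 = 1.
  by move=> F1; rewrite -prodrXl big1.
exists (E * C) => [|s s_adj].
  rewrite exprMn !sqp ?mulr1 // => i _; apply: sqp => j _; rewrite ?/order_sign ?sqrr_sign //.
pose l i := e (s (lshift m i)); pose r i := e (s (rshift m i)).
pose A i := [set l i; r i].
have lE i j : (l i == l j) = (i == j).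
  by rewrite (inj_eq e_inj) (inj_eq perm_inj) (inj_eq (@lshift_inj _ _)).
have rE i j : (r i == r j) = (i == j).
  by rewrite (inj_eq e_inj) (inj_eq perm_inj) (inj_eq (@rshift_inj _ _)).
have lrE i j : (l i == r j) = false.
  by rewrite (inj_eq e_inj) (inj_eq perm_inj) eq_lrshift.
have rlE i j : (r i == l j) = false by rewrite eq_sym lrE.
have inA i j : (l j \in A i = (j == i)) * (r j \in A i = (j == i)).
  by rewrite !inE lE rE lrE rlE orbF.
pose h i j : rat := (-1) ^+ phi (A i) (l j) * (-1) ^+ phi (A i) (r j).
have W_h i : edge_weight (A i) = \prod_(j | j != i) h i j.
  rewrite /edge_weight big_split /=.
  have es_bij : bijective (e \o s) := bij_comp e_bij (Bijective (permK s) (permKV s)).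
  rewrite (reindex (e \o s)) /=; last exact: onW_bij.
  rewrite big_mkcond big_split_ord /= -!big_mkcond /=.
  by congr (_ * _); apply: eq_bigl => j; rewrite -/(l j) -/(r j) inA.
(* Passing to the order [L] of [parity] negates three of the four comparisons, whence the minus
   sign. *)
have cross i j : i != j ->
   order_sign (l i) (l j) * order_sign (r i) (r j) *
     (order_sign (l i) (r j) * order_sign (l j) (r i)) = - (h i j * h j i).
  move=> ij; have dA : [disjoint A i & A j].
    rewrite disjoint_subset; apply/subsetP => x /set2P[]->;
    by rewrite inE /= inA.
  have := parity (s_adj i) (s_adj j) dA.
  rewrite -!/(l _) -!/(r _) -!/(A _).
  have [_ LT] := L_tournament; rewrite /order_sign /h.
  have := LT (l i) (l j); rewrite lE ij => /(_ isT) ->.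
  have := LT (r i) (r j); rewrite rE ij => /(_ isT) ->.
  have := LT (l i) (r j); rewrite lrE => /(_ isT) ->.
  rewrite -!signr_addb -signrN => par; congr (_ ^+ nat_of_bool _).
  move: (L _ _) (L _ _) (L _ _) (L _ _) (phi _ _) (phi _ _) (phi _ _) (phi _ _) par.
  by do 8!case.
have fN a b : a != b -> order_sign (e b) (e a) = - order_sign (e a) (e b).
  move=> ab; rewrite /order_sign (L_tournament.2 (e b)) ?signrN ?opprK //.
  by rewrite (inj_eq e_inj) eq_sym.
have := perm_sign_antisym s (f := fun a b => order_sign (e a) (e b)) fN.
rewrite -/E prod_pairs_split => H.
rewrite [X in _ * X = _](_ : _ = C * \prod_i edge_weight (A i)) in H.
  have C2 : C * C = 1.
    by rewrite -expr2; apply: (sqp) => i _; apply: (sqp).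
  rewrite /edge_sign big_split /=.
  transitivity (((-1) ^+ s * C) * ((-1) ^+ s * E)).
    rewrite -H; set P := \prod_i _; set W := \prod_i _.
    (* [ring] must not see the bodies of the big products. *)
    have scale (x c p w : rat) : c * c = 1 -> x * (p * w) = x * c * (p * (c * w)).
      by move=> c2; rewrite -[p * w]mul1r -c2; ring.
    exact: scale.
  by rewrite mulrACA -expr2 sqrr_sign mul1r mulrC.
rewrite (eq_bigr _ (fun i _ => W_h i)) prod_off_diag -big_split /=.
apply: eq_bigr => i _; rewrite -big_split /=; apply: eq_bigr => j ij.
by rewrite mulN1r -cross // -(inj_eq val_inj) ltn_eqF.
Qed.

End MatchingSign.

(** * Crossing parity of polygons *)

Section Segments.
Variable R : realFieldType.
Implicit Types a b c d v p q : R * R.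

(* Breaking ties by ordinates spares any general position assumption. *)
Definition lex p q := (p.1 < q.1) || ((p.1 == q.1) && (p.2 < q.2)).

(** Twice the signed area of the triangle: negative when [c] is to the right of the line from [a] to
    [b]. *)
Definition cross a b c : R :=
  (b.1 - a.1) * (c.2 - a.2) - (b.2 - a.2) * (c.1 - a.1).

Definition below a b v :=
  if lex a b then [&& lex a v, lex v b & cross a b v < 0]
  else [&& lex b v, lex v a & cross b a v < 0].

Definition disjoint_segments a b c d := forall s t : R,
  0 <= s <= 1 -> 0 <= t <= 1 ->
  (1 - s) * a.1 + s * b.1 = (1 - t) * c.1 + t * d.1 ->
  (1 - s) * a.2 + s * b.2 = (1 - t) * c.2 + t * d.2 -> False.

Lemma lexxx p : lex p p = false.
Proof. by rewrite /lex !ltxx andbF. Qed.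

Lemma lex_trans p q v : lex p q -> lex q v -> lex p v.
Proof.
rewrite /lex => /orP[h|/andP[/eqP h h']] /orP[k|/andP[/eqP k k']].
- by rewrite (lt_trans h k).
- by rewrite -k h.
- by rewrite h k.
- by rewrite h k eqxx (lt_trans h' k') orbT.
Qed.

Lemma lexNlt p q : p != q -> lex q p = ~~ lex p q.
Proof.
case: p q => [x y] [x' y']; rewrite /lex xpair_eqE /=.
by case: (ltgtP x x') => //= _; case: (ltgtP y y').
Qed.

Lemma belowC a b v : below a b v = below b a v.
Proof.
rewrite /below; have [->//|ab] := eqVneq a b.
by rewrite (lexNlt ab); case: (lex a b).
Qed.

Lemma on_segment a b c : lex a c -> lex c b -> cross a b c = 0 ->
  exists2 s, 0 <= s <= 1 &
    (1 - s) * a.1 + s * b.1 = c.1 /\ (1 - s) * a.2 + s * b.2 = c.2.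
Proof.
case: a b c => [x1 y1] [x2 y2] [x3 y3]; rewrite /lex /cross /=.
have [x12|x21] := ltP x1 x2 => h1 h2 h3.
  set s := (x3 - x1) / (x2 - x1).
  have hs : s * (x2 - x1) = x3 - x1 by rewrite divfK; lra.
  exists s; first by rewrite divr_ge0 ?ler_pdivrMr ?mul1r ?subr_gt0 //; lra.
  split; first lra.
  have nz : x2 - x1 != 0 by lra.
  apply: (mulfI nz); transitivity ((x2 - x1) * y1 + s * (x2 - x1) * (y2 - y1)).
    by ring.
  by rewrite hs; lra.
have [e1 e2] : x1 = x3 /\ x2 = x3 by lra.
subst x1 x2; rewrite ltxx eqxx /= in h1 h2.
set s := (y3 - y1) / (y2 - y1).
have hs : s * (y2 - y1) = y3 - y1 by rewrite divfK; lra.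
exists s; first by rewrite divr_ge0 ?ler_pdivrMr ?mul1r ?subr_gt0 //; lra.
by split; lra.
Qed.

Lemma lex_conv a b c t : 0 <= t <= 1 -> lex a b -> lex a c ->
  lex a ((1 - t) * b.1 + t * c.1, (1 - t) * b.2 + t * c.2).
Proof.
case: a b c => [x1 y1] [x2 y2] [x3 y3]; rewrite /lex /= => ht h2 h3.
have [->|t0] := eqVneq t 0; first by rewrite subr0 !mul1r !mul0r !addr0.
have {t0 ht}t0 : 0 < t <= 1 by rewrite lt_def t0.
have [x12|x21] := ltP x1 x2.
  have ? : x1 <= x3 by lra.
  have [->|t1] := eqVneq t 1; first by rewrite subrr !mul1r !mul0r !add0r.
  have t2 : 0 < 1 - t by rewrite subr_gt0 lt_neqAle t1; lra.
  by apply/orP; left; nra.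
have [e h] : x1 = x2 /\ y1 < y2 by lra.
subst x2.
have [x13|x31] := ltP x1 x3; first by apply/orP; left; nra.
have [e h'] : x1 = x3 /\ y1 < y3 by lra.
subst x3.
apply/orP; right; apply/andP; split; first by apply/eqP; ring.
by nra.
Qed.

Lemma conv_lex a b c t : 0 <= t <= 1 -> lex b a -> lex c a ->
  lex ((1 - t) * b.1 + t * c.1, (1 - t) * b.2 + t * c.2) a.
Proof.
pose n p : R * R := (- p.1, - p.2).
have lexN p q : lex (n p) (n q) = lex q p.
  by rewrite /lex /= !ltrN2 eqr_opp eq_sym.
move=> ht hb hc; have := @lex_conv (n a) (n b) (n c) t ht.
rewrite !lexN => /(_ hb hc); rewrite -[lex _ a]lexN /n /=.
by congr (is_true (lex _ _)); congr pair; ring.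
Qed.

(* Solves for the intersection of two segments by Cramer's rule; the
   hypotheses say that each segment meets the line of the other. *)
Lemma cross_meet a b c d :
  disjoint_segments a b c d -> cross a b c <= 0 -> 0 <= cross a b d ->
  0 <= cross c d a -> cross c d b <= 0 -> cross a b c = cross a b d.
Proof.
move=> dis h1 h2 h3 h4; apply/eqP; apply: contraT => ne; exfalso.
pose D := cross a b d - cross a b c.
have D0 : D != 0 by rewrite subr_eq0 eq_sym.
have Dp : 0 < D by rewrite lt_def D0 /D; lra.
have DE : D = cross c d a - cross c d b by rewrite /D /cross; ring.
apply: (dis (cross c d a / D) (- cross a b c / D)).
- by rewrite divr_ge0 ?(ltW Dp) // ler_pdivrMr // mul1r DE; lra.
- by rewrite divr_ge0 ?(ltW Dp) ?ler_pdivrMr // ?mul1r ?/D; lra.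
- by rewrite /D /cross in D0 *; field.
- by rewrite /D /cross in D0 *; field.
Qed.

Lemma lex_sector (p q u v r s : R) :
  lex (0, 0) (p, q) -> lex (0, 0) (u, v) -> lex (0, 0) (r, s) ->
  0 < p * v - q * u -> 0 < u * s - v * r -> 0 < p * s - q * r.
Proof.
rewrite /lex /= => h1 h2 h3 h4 h5.
have E1 : (p * s - q * r) * u = (p * v - q * u) * r + (u * s - v * r) * p by ring.
have r0 : 0 <= r by lra.
have u0 : 0 < u by case/orP: h2 => // /andP[/eqP u0 v0]; rewrite -u0 in h5; nra.
have p0 : 0 < p by case/orP: h1 => // /andP[/eqP p0 q0]; rewrite -p0 in h4; nra.
rewrite -(pmulr_lgt0 _ u0) E1; apply: ltr_wpDl; last exact: mulr_gt0.
by rewrite mulr_ge0 // ltW.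
Qed.

Lemma lex_sub p q : lex p q = lex (0, 0) (q.1 - p.1, q.2 - p.2).
Proof. by rewrite /lex /= !subr_gt0 ![0 == _]eq_sym subr_eq0 (eq_sym q.1). Qed.

Lemma disjoint_segments_sym a b c d :
  disjoint_segments a b c d -> disjoint_segments c d a b.
Proof. by move=> h s t hs ht e1 e2; apply: (h t s). Qed.

Lemma disjoint_segments_swap a b c d :
  disjoint_segments a b c d -> disjoint_segments b a c d.
Proof.
move=> h s t hs ht e1 e2; apply: (h (1 - s) t) => //; first by lra.
  by rewrite -e1; ring.
by rewrite -e2; ring.
Qed.

Lemma disjoint_segments_neq a b c d :
  disjoint_segments a b c d -> a != c.
Proof.
move=> h; apply/eqP => e; apply: (h 0 0); rewrite ?lexx ?ler01 //;
  by rewrite !subr0 !mul1r !mul0r e.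
Qed.

Lemma disjoint_cross a b c d :
  disjoint_segments a b c d -> lex a c -> lex c b -> cross a b c != 0.
Proof.
move=> h ac cb; apply/eqP => /(on_segment ac cb)[s hs [e1 e2]].
by apply: (h s 0); rewrite ?lexx ?ler01 // ?e1 ?e2; ring.
Qed.

(** Otherwise a point of [cd] lies on the line [ab]; by convexity of lexicographic intervals it lies
    between [a] and [b], hence on both segments. *)
Lemma nested_cross a b c d :
  disjoint_segments a b c d -> lex a c -> lex c b -> lex a d -> lex d b ->
  cross a b c < 0 -> cross a b d < 0.
Proof.
move=> dis ac cb ad db h.
have dis' := disjoint_segments_sym (disjoint_segments_swap (disjoint_segments_sym dis)).
have nz : cross a b d != 0 := disjoint_cross dis' ad db.
rewrite lt_neqAle nz leNgt; apply/negP => h'.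
(* [t] is the zero of the affine function [cross a b] along [cd]. *)
pose D := cross a b d - cross a b c; pose t := - cross a b c / D.
have D0 : 0 < D by rewrite /D; lra.
have ht : 0 <= t <= 1 by rewrite divr_ge0 ?ler_pdivrMr ?mul1r /D //; lra.
have [|s hs [/= e1 e2]] := on_segment (lex_conv ht ac ad) (conv_lex ht cb db).
  have {}D0 : D != 0 by lra.
  by rewrite /t /D /cross /= in D0 *; field.
exact: (dis s t).
Qed.

(** If both signs agree, the path from [a] through [c] and [b] to [d] turns twice the same way. Then
    [lex_sector] gives the sign conditions under which the two segments meet. *)
Lemma interleaved_cross a b c d :
  disjoint_segments a b c d -> lex a c -> lex c b -> lex b d ->
  (cross a b c < 0) (+) (cross c d b < 0).
Proof.
move=> dis ac cb bd.
have n1 := disjoint_cross dis ac cb.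
have n2 := disjoint_cross (disjoint_segments_sym (disjoint_segments_swap dis)) cb bd.
have dis' := disjoint_segments_sym (disjoint_segments_swap (disjoint_segments_sym dis)).
rewrite lex_sub in ac; rewrite lex_sub in cb; rewrite lex_sub in bd.
have [h1|h1] := ltP (cross a b c); have [h2|h2] := ltP (cross c d b) => //=.
  have h3 := lex_sector ac cb bd.
  have h4 : 0 < (c.1 - a.1) * (d.2 - b.2) - (c.2 - a.2) * (d.1 - b.1).
    by apply: h3; move: h1 h2; rewrite /cross; lra.
  have h5 : 0 < cross a b d by move: h1 h2 h4; rewrite /cross; lra.
  have h6 : 0 < cross c d a by move: h1 h2 h4; rewrite /cross; lra.
  by have := cross_meet dis (ltW h1) (ltW h5) (ltW h6) (ltW h2); lra.
have {}h1 : 0 < cross a b c by rewrite lt_def n1.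
have {}h2 : 0 < cross c d b by rewrite lt_def n2.
have h3 := lex_sector bd cb ac.
have h4 : 0 < (d.1 - b.1) * (c.2 - a.2) - (d.2 - b.2) * (c.1 - a.1).
  by apply: h3; move: h1 h2; rewrite /cross; lra.
have h5 : cross a b d < 0 by move: h1 h2 h4; rewrite /cross; lra.
have h6 : 0 < cross d c a by move: h1 h2 h4; rewrite /cross; lra.
have h7 : cross d c b < 0 by move: h2; rewrite /cross; lra.
by have := cross_meet dis' (ltW h5) (ltW h1) (ltW h6) (ltW h7); lra.
Qed.

Lemma nested_below a b c d :
  disjoint_segments a b c d -> lex a c -> lex c b -> lex a d -> lex d b ->
  (cross a b c < 0) = (cross a b d < 0).
Proof.
move=> dis ac cb ad db; apply/idP/idP; first exact: nested_cross dis _ _ _ _.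
apply: nested_cross ad db ac cb.
exact/disjoint_segments_sym/disjoint_segments_swap/disjoint_segments_sym.
Qed.

(** After sorting the ends so that [a] comes first, the lexicographic intervals are disjoint, nested
    or interleaved. These give no incidence, two equal ones, or exactly one. Degenerate segments
    make both sides false. *)
Lemma segment_parity a b c d : disjoint_segments a b c d ->
  lex a c (+) lex b c (+) (lex a d (+) lex b d) =
  below a b c (+) below a b d (+) (below c d a (+) below c d b).
Proof.
wlog ab : a b / a == b \/ lex a b.
  move=> W dis; have [e|ne] := eqVneq a b; first by apply: W => //; left; apply/eqP.
  case: (boolP (lex a b)) => [h|h]; first by apply: W => //; right.
  rewrite [lex a c (+) _]addbC [lex a d (+) _]addbC [below c d a (+) _]addbC.
  rewrite !(belowC a b); apply: W; last exact: disjoint_segments_swap.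
  by right; rewrite lexNlt.
wlog cd : c d / c == d \/ lex c d.
  move=> W dis; have [e|ne] := eqVneq c d; first by apply: W => //; left; apply/eqP.
  case: (boolP (lex c d)) => [h|h]; first by apply: W => //; right.
  rewrite addbC [below a b c (+) _]addbC !(belowC c d); apply: W.
    by right; rewrite lexNlt.
  exact/disjoint_segments_sym/disjoint_segments_swap/disjoint_segments_sym.
have below0 p q : below p p q = false.
  rewrite /below lexxx; case: (boolP (lex p q)) => //= pq.
  by rewrite (lexNlt) ?pq //; apply: contraL pq => /eqP->; rewrite lexxx.
case: ab => [/eqP-> _|ab]; first by rewrite !below0 !addbb.
case: cd => [/eqP-> _|cd]; first by rewrite !below0 !addbb.
wlog ac : a b c d ab cd / lex a c.
  move=> W dis; have /orP[h|h] := orbN (lex a c); first exact: W.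
  have dis1 := disjoint_segments_sym dis.
  have ac := disjoint_segments_neq dis.
  have ad := disjoint_segments_neq (disjoint_segments_swap dis1).
  have bc := disjoint_segments_neq (disjoint_segments_swap dis).
  have bd := disjoint_segments_neq (disjoint_segments_swap
     (disjoint_segments_sym (disjoint_segments_swap dis))).
  have ca : lex c a by rewrite lexNlt.
  have := W c d a b cd ab ca dis1.
  rewrite (lexNlt ac) (lexNlt bc) (lexNlt ad) (lexNlt bd).
  rewrite [RHS]addbC => <-.
  by move: (lex a c) (lex d a) (lex b c) (lex d b) => [] [] [] [].
move=> dis.
have dis' := disjoint_segments_sym (disjoint_segments_swap (disjoint_segments_sym dis)).
have bc := disjoint_segments_neq (disjoint_segments_swap dis).
have bd := disjoint_segments_neq (disjoint_segments_swap dis').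
have ca : lex c a = false by rewrite lexNlt ?ac // (disjoint_segments_neq dis).
have ad := lex_trans ac cd.
have da : lex d a = false by rewrite lexNlt ?ad // (disjoint_segments_neq dis').
rewrite /below ab cd ac ad ca (lexNlt bc) (lexNlt bd) /= ?addbF.
have /orP[bc'|cb] := orbN (lex b c).
  by rewrite bc' (lex_trans bc' cd).
have {}cb' : lex c b by rewrite lexNlt.
rewrite (negbTE cb) /=.
have /orP[bd'|db] := orbN (lex b d).
  by rewrite bd' /= addbF; have := interleaved_cross dis ac cb' bd' => ->.
have db' : lex d b by rewrite lexNlt.
by rewrite (negbTE db) /= (nested_below dis ac cb' ad db') addbb.
Qed.

Definition polygon_below N (a : nat -> R * R) v :=
  \big[addb/false]_(i < N) below (a i) (a i.+1) v.

(** Summing [segment_parity] over all pairs of segments, the terms at interior vertices appear twice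
    and cancel modulo 2. *)
Lemma polygon_parity N M (a b : nat -> R * R) :
  (forall i j, (i < N)%N -> (j < M)%N ->
     disjoint_segments (a i) (a i.+1) (b j) (b j.+1)) ->
  lex (a 0) (b 0) (+) lex (a N) (b 0) (+) (lex (a 0) (b M) (+) lex (a N) (b M)) =
  polygon_below N a (b 0) (+) polygon_below N a (b M)
    (+) (polygon_below M b (a 0) (+) polygon_below M b (a N)).
Proof.
have xor4 (A B C p q r u v u' v' : bool) :
    A (+) B = p (+) q (+) (u (+) v) -> B (+) C = q (+) r (+) (u' (+) v') ->
    A (+) C = p (+) r (+) (u (+) u' (+) (v (+) v')).
  by move: A B C p q r u v u' v'; do 10!case.
have seg x y : (forall j, (j < M)%N -> disjoint_segments x y (b j) (b j.+1)) ->
    lex x (b 0) (+) lex y (b 0) (+) (lex x (b M) (+) lex y (b M)) =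
    below x y (b 0) (+) below x y (b M)
      (+) (polygon_below M b x (+) polygon_below M b y).
  rewrite /polygon_below; elim: (M) => [|K IH] dis; first by rewrite !big_ord0 !addbb.
  rewrite !big_ord_recr /=; apply: xor4 (segment_parity (dis K _)) => //.
  by apply: IH => j jK; apply: dis; apply: ltnW.
elim: N => [|N IH] dis; first by rewrite /polygon_below !big_ord0 addbACA !addbb.
have h1 := IH (fun i j iN => dis i j (ltnW iN)).
have h2 := seg _ _ (fun j => dis N j (ltnSn N)).
rewrite addbACA [RHS]addbC in h1; rewrite addbACA [RHS]addbC in h2.
rewrite addbACA [RHS]addbC {3 4}/polygon_below !big_ord_recr /=.
exact: xor4 h1 h2.
Qed.

End Segments.

(** * Plane drawings *)

From mathcomp Require Import all_classical all_reals all_analysis.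
Import numFieldNormedType.Exports.
Local Open Scope classical_set_scope.
Local Open Scope ring_scope.

Section Arcs.
Variable R : realType.

Lemma arc_continuous (f : R -> R * R) (s0 e : R) :
  {within `[0, 1]%classic, continuous f} -> s0 \in `[0, 1] -> 0 < e ->
  exists2 h, 0 < h & forall s, s \in `[0, 1] -> `|s0 - s| < h ->
    `|(f s0).1 - (f s).1| < e /\ `|(f s0).2 - (f s).2| < e.
Proof.
move=> /subspace_continuousP cf s01 e0.
have := cf s0 s01 _ (nbhsx_ballx (f s0) e e0).
rewrite nbhs_simpl /= /within /= => /nbhs_ballP[h /= h0 hb].
exists h => // s s1 hs; have /= := hb s; rewrite /ball /= => /(_ hs s1) [].
by [].
Qed.

Lemma conv_near (x e a b s : R) : `|x - a| < e -> `|x - b| < e -> 0 <= s <= 1 ->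
  `|x - ((1 - s) * a + s * b)| < e.
Proof.
rewrite !ltr_norml => ha hb hs.
rewrite (_ : x - _ = (1 - s) * (x - a) + s * (x - b)); last by ring.
have [->|s0] := eqVneq s 0; first by rewrite subr0 mul1r mul0r addr0.
have {}s0 : 0 < s by rewrite lt_def s0; lra.
by nra.
Qed.

(** Open squares of half-side [e] whose centres differ by at least [2 * e] in some coordinate are
    disjoint, and they are convex. *)
Lemma near_disjoint_segments (p q a b c d : R * R) (e : R) :
  `|p.1 - a.1| < e /\ `|p.2 - a.2| < e -> `|p.1 - b.1| < e /\ `|p.2 - b.2| < e ->
  `|q.1 - c.1| < e /\ `|q.2 - c.2| < e -> `|q.1 - d.1| < e /\ `|q.2 - d.2| < e ->
  2 * e <= `|p.1 - q.1| \/ 2 * e <= `|p.2 - q.2| -> disjoint_segments a b c d.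
Proof.
move=> [a1 a2] [b1 b2] [c1 c2] [d1 d2] pq s t hs ht e1 e2.
have := conv_near a1 b1 hs; have := conv_near a2 b2 hs; rewrite e1 e2.
have := conv_near c1 d1 ht; have := conv_near c2 d2 ht.
move: ((1 - t) * c.1 + t * d.1) ((1 - t) * c.2 + t * d.2) => u v h1 h2 h3 h4.
case: pq; rewrite leNgt => /negP; apply.
  by have := ler_distD u p.1 q.1; rewrite [`|u - _|]distrC; lra.
by have := ler_distD v p.2 q.2; rewrite [`|v - _|]distrC; lra.
Qed.

Lemma dist_halves (x y z e h : R) :
  `|x - y| < e / 2 -> `|y - z| < h -> h < e / 2 -> `|x - z| < e.
Proof. by have := ler_distD y x z; lra. Qed.

(** A suitable mesh exists near each pair of parameters by continuity; compactness of the unit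
    square makes it uniform. *)
Lemma separated_arcs (f g : R -> R * R) :
  {within `[0, 1]%classic, continuous f} -> {within `[0, 1]%classic, continuous g} ->
  (forall s t, s \in `[0, 1] -> t \in `[0, 1] -> f s <> g t) ->
  \forall h \near (0 : R)^'+, forall s s' t t',
    s \in `[0, 1] -> s' \in `[0, 1] -> t \in `[0, 1] -> t' \in `[0, 1] ->
    `|s - s'| < h -> `|t - t'| < h -> disjoint_segments (f s) (f s') (g t) (g t').
Proof.
move=> cf cg fg.
have K : compact (`[(0 : R), 1]%classic `*` `[(0 : R), 1]%classic).
  by apply: compact_setX; exact: segment_compact.
pose P h (z : R * R) := forall s' t', z.1 \in `[0, 1] -> s' \in `[0, 1] ->
  z.2 \in `[0, 1] -> t' \in `[0, 1] ->
  `|z.1 - s'| < h -> `|z.2 - t'| < h -> disjoint_segments (f z.1) (f s') (g z.2) (g t').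
have : \forall h \near (0 : R)^'+, (`[(0 : R), 1]%classic `*` `[(0 : R), 1]%classic) `<=` P h.
  apply: (iffLR (compact_near_coveringP _) K) => -[s0 t0] [/= s01 t01].
  have [e e0 he] : exists2 e, 0 < e & 2 * e <= `|(f s0).1 - (g t0).1| \/
     2 * e <= `|(f s0).2 - (g t0).2|.
    have [e1|n1] := eqVneq (f s0).1 (g t0).1; last first.
      exists (`|(f s0).1 - (g t0).1| / 2); last by left; lra.
      by rewrite divr_gt0 // normr_gt0 subr_eq0.
    have [e2|n2] := eqVneq (f s0).2 (g t0).2; last first.
      exists (`|(f s0).2 - (g t0).2| / 2); last by right; lra.
      by rewrite divr_gt0 // normr_gt0 subr_eq0.
    by case: (fg _ _ s01 t01); case: (f s0) (g t0) e1 e2 => ? ? [? ?] /= -> ->.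
  have [h1 h10 H1] := arc_continuous cf s01 e0.
  have [h2 h20 H2] := arc_continuous cg t01 e0.
  have nb1 : \forall z \near (s0, t0), `|s0 - z.1| < h1 / 2.
    apply: (@cvg_fst _ _ _ _ _ [set s | `|s0 - s| < h1 / 2]);
      by apply: nbhsx_ballx; rewrite divr_gt0.
  have nb2 : \forall z \near (s0, t0), `|t0 - z.2| < h2 / 2.
    apply: (@cvg_snd _ _ _ _ _ [set s | `|t0 - s| < h2 / 2]);
      by apply: nbhsx_ballx; rewrite divr_gt0.
  near=> z h.
  have hh1 : h < h1 / 2 by near: h; apply: nbhs_right_lt; rewrite divr_gt0.
  have hh2 : h < h2 / 2 by near: h; apply: nbhs_right_lt; rewrite divr_gt0.
  have z1 : `|s0 - z.1| < h1 / 2.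
    by near: z; apply: nb1.
  have z2 : `|t0 - z.2| < h2 / 2.
    by near: z; apply: nb2.
  move=> s' t' zs s'1 zt t'1 d1 d2.
  apply: near_disjoint_segments he; [apply: H1|apply: H1|apply: H2|apply: H2] => //.
  - by lra.
  - exact: dist_halves z1 d1 hh1.
  - by lra.
  - exact: dist_halves z2 d2 hh2.
apply: filterS => h H s s' t t' s1 s1' t1 t1' d1 d2.
by apply: (H (s, t)).
Unshelve. all: by end_near.
Qed.

(** Each point of an arc is interior or is the image of an end; the drawing conditions treat
    interior points, and disjoint edges share no end. *)
Lemma drawing_disjoint (G : sgraph) (p : G -> R * R) (c : {set G} -> R -> R * R)
    (A B : {set G}) (s t : R) :
  plane_drawing p c -> A \in edges G -> B \in edges G -> [disjoint A & B]%B ->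
  s \in `[0, 1] -> t \in `[0, 1] -> c A s <> c B t.
Proof.
move=> [p_inj _ ends avoid cross0] EA EB AB.
have AneB : A != B.
  have [u [v [A_uv _ _]]] := ends A EA.
  by apply: contraTneq AB => <-; apply/pred0Pn; exists u; rewrite /= A_uv !inE eqxx.
have end_or (C : {set G}) (r : R) : C \in edges G -> r \in `[0, 1] ->
    (exists2 x, x \in C & c C r = p x) \/ r \in `]0, 1[.
  move=> EC; rewrite !in_itv /=; have [u [v [C_uv c0 c1]]] := ends C EC.
  have [->|r0] := eqVneq r 0; first by left; exists u; rewrite // C_uv !inE eqxx.
  have [->|r1] := eqVneq r 1; first by left; exists v; rewrite // C_uv !inE eqxx orbT.
  by move=> /andP[r0' r1']; right; rewrite !lt_def r0 r0' r1' eq_sym r1.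
move=> s01 t01; have [[x xA ->]|sI] := end_or _ _ EA s01;
  have [[y yB ->]|tI] := end_or _ _ EB t01.
- by move=> /p_inj xy; rewrite -xy (disjointFr AB xA) in yB.
- by move=> /esym; apply: avoid.
- exact: avoid.
- exact: cross0.
Qed.

(** There are finitely many pairs of edges, so one mesh serves them all. *)
Lemma drawing_polygons (G : sgraph) (p : G -> R * R) (c : {set G} -> R -> R * R) :
  plane_drawing p c -> exists N : nat, forall A B i j,
    A \in edges G -> B \in edges G -> [disjoint A & B]%B ->
    (i < N.+1)%N -> (j < N.+1)%N ->
    disjoint_segments (c A (i%:R / N.+1%:R)) (c A (i.+1%:R / N.+1%:R))
                      (c B (j%:R / N.+1%:R)) (c B (j.+1%:R / N.+1%:R)).
Proof.
move=> drw.
have [_ cont _ _ _] := drw.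
pose Q (AB : {set G} * {set G}) (h : R) :=
  AB.1 \in edges G -> AB.2 \in edges G -> [disjoint AB.1 & AB.2]%B ->
  forall s s' t t', s \in `[0, 1] -> s' \in `[0, 1] -> t \in `[0, 1] -> t' \in `[0, 1] ->
  `|s - s'| < h -> `|t - t'| < h ->
  disjoint_segments (c AB.1 s) (c AB.1 s') (c AB.2 t) (c AB.2 t').
have : \forall h \near (0 : R)^'+, forall AB, Q AB h.
  apply: filter_forall => -[A B]; rewrite /Q /=.
  have [EA|/negP nA] := boolP (A \in edges G); last by apply: nearW.
  have [EB|/negP nB] := boolP (B \in edges G); last by apply: nearW.
  have [dAB|/negP nAB] := boolP [disjoint A & B]%B; last by apply: nearW.
  have := separated_arcs (cont A EA).1 (cont B EB).1.
  move=> /(_ (fun s t => drawing_disjoint drw EA EB dAB)).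
  by apply: filterS => h H _ _ _.
move=> H; have [h [h0 Qh]] : exists h, 0 < h /\ forall AB, Q AB h.
  near (0 : R)^'+ => h; exists h; split; first by near: h; exact: nbhs_right_gt.
  by near: h.
exists (Num.truncn h^-1) => A B i j EA EB dAB iN jN.
set n := (Num.truncn h^-1).+1; have n0 : 0 < n%:R :> R by rewrite ltr0n.
have nh : n%:R^-1 < h by rewrite invf_plt ?posrE // truncnS_gt.
have itv (k : nat) : (k <= n)%N -> (k%:R / n%:R : R) \in `[0, 1].
  by move=> kn; rewrite in_itv /= divr_ge0 //= ler_pdivrMr // mul1r ler_nat.
have step (k : nat) : `|k%:R / n%:R - k.+1%:R / n%:R| < h :> R.
  by rewrite -mulrBl -natr1 opprD addNKr mulN1r normrN gtr0_norm ?invr_gt0.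
by apply: (Qh (A, B)) => //; apply: itv => //; apply: ltnW.
Unshelve. all: by end_near.
Qed.

End Arcs.

Lemma lex_tournament (R : realType) (T : finType) (p : T -> R * R) :
  injective p -> tournament (fun u v => lex (p u) (p v)).
Proof.
move=> p_inj; split=> [u|u v uv]; first exact: lexxx.
by apply: lexNlt; rewrite (inj_eq p_inj).
Qed.

Lemma planar_parity (R : realType) (G : sgraph) : planar R G ->
  exists (L : rel G) (phi : {set G} -> G -> bool), tournament L /\
  forall a b c d, adj a b -> adj c d ->
  [disjoint [set a; b]%SET & [set c; d]%SET]%B ->
  L a c (+) L b c (+) (L a d (+) L b d) =
  phi [set a; b]%SET c (+) phi [set a; b]%SET d (+)
  (phi [set c; d]%SET a (+) phi [set c; d]%SET b).
Proof.
move=> [p [arc drw]]; have [N sep] := drawing_polygons drw.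
have [p_inj _ ends _ _] := drw.
pose q A (i : nat) : R * R := arc A (i%:R / N.+1%:R).
exists (fun u v => lex (p u) (p v)), (fun A v => polygon_below N.+1 (q A) (p v)).
split=> [|a b c d ab cd dis]; first exact: lex_tournament.
have Eab : [set a; b]%SET \in edges G by rewrite edge_set2.
have Ecd : [set c; d]%SET \in edges G by rewrite edge_set2.
have := polygon_parity (fun i j => sep _ _ i j Eab Ecd dis).
(* An arc may be traversed in either direction; the parity identity is symmetric under this
   choice. *)
have q_ends u v : adj u v -> let A := [set u; v]%SET in
    q A 0 = p u /\ q A N.+1 = p v \/ q A 0 = p v /\ q A N.+1 = p u.
  move=> uv A; rewrite /q mul0r divff ?pnatr_eq0 //.
  have [|u' [v' [E -> ->]]] := ends A; first by rewrite edge_set2.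
  have u'v' : u' != v'.
    apply: contraTneq uv => u'v'; have /setP AE := E; rewrite u'v' in AE.
    have := AE u; have := AE v; rewrite !inE !eqxx orbT !orbb.
    by move=> /esym/eqP-> /esym/eqP->; rewrite adj_irrefl.
  have /set2P u'E : u' \in [set u; v]%SET by rewrite -/A E !inE eqxx.
  have /set2P v'E : v' \in [set u; v]%SET by rewrite -/A E !inE eqxx orbT.
  by case: u'E v'E u'v' => -> [] ->; rewrite ?eqxx //; [left|right].
rewrite -!/(q _ _).
have [[-> ->]|[-> ->]] := q_ends a b ab; have [[-> ->]|[-> ->]] := q_ends c d cd.
all: move: (lex (p a) (p c)) (lex (p a) (p d)) (lex (p b) (p c)) (lex (p b) (p d)).
all: move: (polygon_below _ _ (p a)) (polygon_below _ _ (p b)).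
all: by move: (polygon_below _ _ (p c)) (polygon_below _ _ (p d)); do 8!case.
Qed.

(** A perfect matching makes the number of vertices even, which allows indexing by ['I_(m + m)]. The
    orientation is read off the edge signs, under which all listings have the same sign. *)
Lemma planar_num_pm (R : realType) (G : sgraph) : planar R G -> (0 < num_pm G)%N ->
  exists2 o : rel G, orientation o &
    (num_pm G)%:R ^+ 2 <= `|\det (skew_adj_mx o)|.
Proof.
move=> /planar_parity[L [phi [LT par]]] /card_gt0P[M]; rewrite inE => pM.
set m := #|M|; have GE : #|G| = (m + m)%N := pm_card pM.
pose e (i : 'I_(m + m)) : G := enum_val (cast_ord (esym GE) i).
have e_bij : bijective e.
  by apply: bij_comp (@enum_val_bij _) _; exists (cast_ord GE) => i;
    rewrite (cast_ordK, cast_ordKV).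
have [K K2 sK] := matching_sign e_bij LT par.
have sN u v : adj u v -> edge_sign L phi v u = - edge_sign L phi u v.
  move=> uv; rewrite /edge_sign /order_sign (LT.2 v) ?signrN ?mulNr ?opprK 1?finset.setUC //.
  by apply: contraTneq uv => ->; rewrite adj_irrefl.
have s2 u v : edge_sign L phi u v ^+ 2 = 1.
  rewrite exprMn sqrr_sign mul1r /edge_weight -prodrXl big1 // => x _.
  by rewrite sqrr_sign.
exists (signed_orientation (edge_sign L phi)); first exact: signed_orientationP.
apply: num_pm_sqr_le_det e_bij sN s2 K2 _ => t /forallP.
exact: sK.
Qed.

(** * The bound and its equality case *)

(** The weights satisfy 3^4 = 3^4 for [K_4] and 9^4 = 3^8 for the cube, and both sides multiply over
    the components. *)
Lemma union_num_pm_ge (G : sgraph) (I : finType) (F : I -> sgraph) :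
  (forall i, isomorphic (F i) (complete_graph 4) \/ isomorphic (F i) cube) ->
  isomorphic G (disjoint_union F) -> (3 ^ #|G| <= num_pm G ^ 4)%N.
Proof.
move=> FP GF; pose w i : nat := if #|F i| == 4 then 3%N else 9%N.
have iso_card (H H' : sgraph) : isomorphic H H' -> #|H| = #|H'|.
  by case=> f /bij_eq_card.
have wP i : matching_family (F i) 'I_(w i) /\ (w i ^ 4 = 3 ^ #|F i|)%N.
  rewrite /w; case: (FP i) => FH; rewrite (iso_card _ _ FH).
    by rewrite card_ord /=; split=> //; apply: matching_family_iso FH K4_matchings.
  by rewrite card_prod !card_ord /=; split=> //; apply: matching_family_iso FH cube_matchings.
have := matching_family_le (matching_family_iso GF (matching_family_union (fun i => (wP i).1))).
rewrite -(leq_exp2r _ _ (isT : 0 < 4)%N); apply: leq_trans.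
rewrite (iso_card _ _ GF) card_tagged card_dep_ffun /image_mem.
elim: (enum I) => //= i s IH; rewrite expnMn card_ord (wP i).2 expnD.
by rewrite leq_mul2l IH orbT.
Qed.

Lemma powR_quarterX (R : realType) (n : nat) :
  ((3%:R : R) `^ (n%:R / 4%:R)) ^+ 4 = (3 ^ n)%:R.
Proof. by rewrite -powR_mulrn ?powR_ge0 // -powRrM divfK // powR_mulrn // natrX. Qed.

Lemma le_powR_quarter (R : realType) (N n : nat) :
  (N%:R <= (3%:R : R) `^ (n%:R / 4%:R)) = (N ^ 4 <= 3 ^ n)%N.
Proof.
by rewrite -(ler_pXn2r (isT : 0 < 4)%N) ?nnegrE ?powR_ge0 // powR_quarterX -natrX ler_nat.
Qed.

Lemma eq_powR_quarter (R : realType) (N n : nat) :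
  (N%:R == (3%:R : R) `^ (n%:R / 4%:R)) = (N ^ 4 == 3 ^ n)%N.
Proof.
by rewrite -(eqrXn2 (isT : 0 < 4)%N) ?powR_ge0 // powR_quarterX -natrX eqr_nat.
Qed.

(** Squaring the hypothesis places the squared determinant between the two sides. Equality of the
    outer terms is therefore equality in Hadamard's inequality. *)
Lemma det_num_pm_le (G : sgraph) (o : rel G) :
  regular 3 G -> orientation o ->
  (num_pm G)%:R ^+ 2 <= `|\det (skew_adj_mx o)| ->
  (num_pm G ^ 4 <= 3 ^ #|G|)%N /\
  ((num_pm G ^ 4 = 3 ^ #|G|)%N -> forall u v : G, u != v -> ~~ odd #|common_nbrs u v|).
Proof.
move=> G3 oP le; have [det_le det_eq] := regular_det_le G3 oP.
have le4 : (num_pm G ^ 4)%:R <= \det (skew_adj_mx o) ^+ 2 :> int.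
  rewrite natrX (exprM _ 2 2) -[leRHS]real_normK ?num_real //.
  by rewrite lerXn2r ?nnegrE ?exprn_ge0.
rewrite -(ler_nat int) !natrX; split; first by rewrite -natrX; apply: le_trans det_le.
move=> E; apply: det_eq => //; apply/eqP; rewrite eq_le det_le /=.
by apply: le_trans le4; rewrite E natrX.
Qed.

Theorem theorem4p1 (R : realType) (G : sgraph) (G_cubic : regular 3 G) :
  (pfaffian G ->
     (num_pm G)%:R <= (3%:R : R) `^ (#|G|%:R / 4%:R)) /\
  (planar R G ->
     ((num_pm G)%:R = (3%:R : R) `^ (#|G|%:R / 4%:R) <->
      exists (I : finType) (F : I -> sgraph),
        (forall i : I,
           isomorphic (F i) (complete_graph 4) \/
           isomorphic (F i)
             (cartesian_product (cycle_graph 4) (complete_graph 2))) /\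
        isomorphic G (disjoint_union F))).
Proof.
split=> [[ori [ori_or ori_det]]|planarG].
  by rewrite le_powR_quarter (det_num_pm_le G_cubic ori_or _).1 // ori_det ger0_norm ?sqr_ge0.
split=> [/eqP|[I [F [FP GF]]]].
  rewrite eq_powR_quarter => /eqP E.
  (* A power of 3 is positive, so equality itself provides a perfect matching. *)
  have N0 : (0 < num_pm G)%N by rewrite -(ltn_exp2r 0 _ (isT : 0 < 4)%N) E expn_gt0.
  have [ori ori_or le] := planar_num_pm planarG N0.
  by have [_ /(_ E)] := det_num_pm_le G_cubic ori_or le; exact: cubic_even_union.
have ge := union_num_pm_ge FP GF.
have N0 : (0 < num_pm G)%N.
  by rewrite -(ltn_exp2r 0 _ (isT : 0 < 4)%N) (leq_trans _ ge) // expn_gt0.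
have [ori ori_or le] := planar_num_pm planarG N0.
have [le4 _] := det_num_pm_le G_cubic ori_or le.
by apply/eqP; rewrite eq_powR_quarter eqn_leq le4 ge.
Qed.
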